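(* Let $\mathfrak g$ be a complex Lie superalgebra, $\mathfrak p$ a ($\mathbb Z_2$-graded) ideal of $\mathfrak g$, and $\phi\colon\mathfrak p\to\mathbb C$ a Lie superalgebra homomorphism. The universal quasi-Whittaker supermodule $W(\phi)$ is irreducible if and only if one of the following conditions holds: (1) $\mathfrak g^\phi=\mathfrak p$; (2) $\mathfrak g^\phi_{\bar 0}=\mathfrak p_{\bar 0}$, $\dim \mathfrak g^\phi_{\bar 1}/\mathfrak p_{\bar 1}=1$, and $\phi\bigl([\mathfrak g^\phi_{\bar 1},\mathfrak g^\phi_{\bar 1}]\bigr)\neq 0$.
   Context: All Lie superalgebras and supermodules are over $\mathbb C$, of arbitrary dimension; $\mathbb C$ is regarded as a purely even abelian Lie superalgebra (so $\phi$ vanishes on $\mathfrak p_{\bar 1}$ and on $[\mathfrak p,\mathfrak p]$). The Whittaker annihilator of $\phi$ is $\mathfrak g^\phi=\{y\in\mathfrak g\mid \phi([y,p])=0\ \forall p\in\mathfrak p\}$; it is a graded subalgebra containing $\mathfrak p$. Let $\mathbb C w_\phi$ be the one-dimensional $\mathfrak p$-supermodule, with $w_\phi$ even, given by $pw_\phi=\phi(p)w_\phi$; the universal quasi-Whittaker supermodule is $W(\phi)=\mathrm{Ind}_{\mathfrak p}^{\mathfrak g}\mathbb C w_\phi=\mathcal U(\mathfrak g)\otimes_{\mathcal U(\mathfrak p)}\mathbb C w_\phi$. Irreducible means having no nonzero proper ($\mathbb Z_2$-graded) subsupermodule. *)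

(* Defs.v *)
From HB Require Import structures.
From mathcomp Require Import all_boot all_order all_algebra.
From mathcomp Require Import boolp reals.
From mathcomp Require Export complex.

Set Implicit Arguments.
Unset Strict Implicit.
Unset Printing Implicit Defensive.

Import Order.TTheory GRing.Theory Num.Theory.
Local Open Scope ring_scope.
Local Open Scope quotient_scope.

Definition span_of (K : numFieldType) (V : lmodType K) (S : V -> Prop)
    : {pred V} :=
  [pred v | `[< forall N : {pred V},
                submod_closed N -> (forall s, S s -> s \in N) -> v \in N >]].

(* [quot_dim V W n]: the quotient space V / W has dimension n, i.e. there are
   n vectors of V whose classes modulo W form a basis of V / W. *)
Definition quot_dim (K : numFieldType) (L : lmodType K) (V W : {pred L})
    (n : nat) : Prop :=
  {subset W <= V} /\
  exists e : 'I_n -> L,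
    (forall i, e i \in V) /\
    (forall v, v \in V ->
       exists! a : 'rV[K]_n, v - \sum_(i < n) a 0 i *: e i \in W).

(* Parities are booleans: [false] is even, [true] is odd, and the sum of
   parities is [(+)] (addb). *)
Record superspace (K : numFieldType) := SuperSpace {
  ss_sort :> lmodType K;
  hcomp : bool -> {pred ss_sort};
  hcomp_closed : forall i, submod_closed (hcomp i);
  hcomp_sum : forall v, exists v0 v1,
    [/\ v0 \in hcomp false, v1 \in hcomp true & v = v0 + v1];
  hcomp_cap : forall v, v \in hcomp false -> v \in hcomp true -> v = 0
}.
Arguments hcomp {K} V i : rename.
Arguments hcomp_closed {K} V i : rename.

Definition graded_pred (K : numFieldType) (V : superspace K) (N : {pred V}) :=
  forall v, v \in N -> exists v0 v1,
    [/\ v0 \in N, v0 \in hcomp V false, v1 \in N, v1 \in hcomp V true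
      & v = v0 + v1].

Definition part (K : numFieldType) (V : superspace K) (N : {pred V}) (i : bool)
    : {pred V} := [pred v | (v \in N) && (v \in hcomp V i)].

Definition ssign (K : numFieldType) (i j : bool) : K := (-1) ^+ (i && j).

Record lieSuperalgebra (K : numFieldType) := LieSuperalgebra {
  lsa_space :> superspace K;
  br : lsa_space -> lsa_space -> lsa_space;
  br_linr : forall x, linear (br x);
  br_linl : forall y, linear (br^~ y);
  br_hom : forall i j x y,
    x \in hcomp lsa_space i -> y \in hcomp lsa_space j ->
    br x y \in hcomp lsa_space (i (+) j);
  br_skew : forall i j x y,
    x \in hcomp lsa_space i -> y \in hcomp lsa_space j ->
    br x y = - (ssign K i j *: br y x);
  br_jacobi : forall i j x y z,
    x \in hcomp lsa_space i -> y \in hcomp lsa_space j ->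
    br x (br y z) = br (br x y) z + ssign K i j *: br y (br x z)
}.

Record lieHom (K : numFieldType) (g h : lieSuperalgebra K) := LieHom {
  lh_fun :> g -> h;
  lh_lin : linear lh_fun;
  lh_hom : forall i x, x \in hcomp g i -> lh_fun x \in hcomp h i;
  lh_br : forall x y, lh_fun (br x y) = br (lh_fun x) (lh_fun y)
}.

Record supermodule (K : numFieldType) (g : lieSuperalgebra K) := Supermodule {
  sm_space :> superspace K;
  sact : g -> sm_space -> sm_space;
  sact_linr : forall x, linear (sact x);
  sact_linl : forall m, linear (sact^~ m);
  sact_hom : forall i j x m, x \in hcomp g i -> m \in hcomp sm_space j ->
    sact x m \in hcomp sm_space (i (+) j);
  sact_br : forall i j x y m, x \in hcomp g i -> y \in hcomp g j ->
    sact (br x y) m = sact x (sact y m) - ssign K i j *: sact y (sact x m)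
}.

Definition subsupermodule (K : numFieldType) (g : lieSuperalgebra K)
    (M : supermodule g) (N : {pred M}) : Prop :=
  [/\ submod_closed N, graded_pred N
    & forall (x : g) m, m \in N -> sact x m \in N].

Definition irreducible (K : numFieldType) (g : lieSuperalgebra K)
    (M : supermodule g) : Prop :=
  forall N : {pred M}, subsupermodule N ->
    (forall m, m \in N -> m = 0) \/ (forall m, m \in N).

Record gradedIdeal (K : numFieldType) (g : lieSuperalgebra K) := GradedIdeal {
  gi_pred :> {pred g};
  gi_submod : submod_closed gi_pred;
  gi_graded : graded_pred gi_pred;
  gi_ideal : forall x y, y \in gi_pred -> br x y \in gi_pred
}.

HB.instance Definition _ (K : numFieldType) (g : lieSuperalgebra K)
    (p : gradedIdeal g) :=
  GRing.isSubmodClosed.Build K g (gi_pred p) (gi_submod p).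

Section IdealLie.
Variables (K : numFieldType) (g : lieSuperalgebra K) (p : gradedIdeal g).

Record ideal_type := IdealType { ival : g; _ : ival \in gi_pred p }.

HB.instance Definition _ := [isSub for ival].
HB.instance Definition _ := [Choice of ideal_type by <:].
HB.instance Definition _ := [SubChoice_isSubLmodule of ideal_type by <:].

Definition ideal_hcomp (i : bool) : {pred ideal_type} :=
  [pred x | ival x \in hcomp g i].

Lemma ideal_hcomp_closed i : submod_closed (ideal_hcomp i).
Proof.
have [h0 hl] := hcomp_closed g i; split; first by rewrite inE.
by move=> a u v; rewrite !inE => hu hv; exact: hl.
Qed.

Lemma ideal_hcomp_sum v : exists v0 v1,
  [/\ v0 \in ideal_hcomp false, v1 \in ideal_hcomp true & v = v0 + v1].
Proof.
have [v0 [v1 [p0 h0 p1 h1 e]]] := gi_graded (valP v).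
exists (IdealType p0), (IdealType p1); rewrite !inE; split=> //.
exact: val_inj.
Qed.

Lemma ideal_hcomp_cap v :
  v \in ideal_hcomp false -> v \in ideal_hcomp true -> v = 0.
Proof.
by rewrite !inE => h0 h1; apply: val_inj; exact: (hcomp_cap h0 h1).
Qed.

Definition ideal_superspace : superspace K :=
  SuperSpace ideal_hcomp_closed ideal_hcomp_sum ideal_hcomp_cap.

Definition ideal_ad (y : g) (x : ideal_type) : ideal_type :=
  IdealType (gi_ideal y (valP x)).

Definition ideal_br (x y : ideal_superspace) : ideal_superspace :=
  ideal_ad (ival x) y.

Lemma ideal_br_linr x : linear (ideal_br x).
Proof. by move=> a u v; apply: val_inj; exact: br_linr. Qed.

Lemma ideal_br_linl y : linear (ideal_br^~ y).
Proof. by move=> a u v; apply: val_inj; exact: (br_linl (ival y)). Qed.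

Lemma ideal_br_hom i j x y :
  x \in hcomp ideal_superspace i -> y \in hcomp ideal_superspace j ->
  ideal_br x y \in hcomp ideal_superspace (i (+) j).
Proof. by rewrite !inE; exact: br_hom. Qed.

Lemma ideal_br_skew i j x y :
  x \in hcomp ideal_superspace i -> y \in hcomp ideal_superspace j ->
  ideal_br x y = - (ssign K i j *: ideal_br y x).
Proof.
by rewrite !inE => hx hy; apply: val_inj; exact: (br_skew hx hy).
Qed.

Lemma ideal_br_jacobi i j x y z :
  x \in hcomp ideal_superspace i -> y \in hcomp ideal_superspace j ->
  ideal_br x (ideal_br y z) =
  ideal_br (ideal_br x y) z + ssign K i j *: ideal_br y (ideal_br x z).
Proof.
by rewrite !inE => hx hy; apply: val_inj; exact: (br_jacobi _ hx hy).
Qed.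

Definition ideal_lie : lieSuperalgebra K :=
  LieSuperalgebra ideal_br_linr ideal_br_linl ideal_br_hom ideal_br_skew
    ideal_br_jacobi.

Lemma ival_lin : linear (ival : ideal_lie -> g).
Proof. by []. Qed.

Lemma ival_hom i (x : ideal_lie) : x \in hcomp ideal_lie i -> ival x \in hcomp g i.
Proof. by rewrite inE. Qed.

Definition ideal_incl : lieHom ideal_lie g :=
  @LieHom K ideal_lie g ival ival_lin ival_hom (fun _ _ => erefl).

End IdealLie.

Coercion ideal_lie : gradedIdeal >-> lieSuperalgebra.

Section Ground.
Variable K : numFieldType.

Definition ground_hcomp (i : bool) : {pred K^o} :=
  [pred v | ~~ i || (v == 0)].

Lemma ground_hcomp_closed i : submod_closed (ground_hcomp i).
Proof.
split; first by rewrite inE eqxx orbT.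
move=> a u v; rewrite !inE; case: i => //= /eqP -> /eqP ->.
by rewrite scaler0 addr0.
Qed.

Lemma ground_hcomp_sum v : exists v0 v1,
  [/\ v0 \in ground_hcomp false, v1 \in ground_hcomp true & v = v0 + v1].
Proof. by exists v, 0; rewrite !inE eqxx addr0. Qed.

Lemma ground_hcomp_cap v :
  v \in ground_hcomp false -> v \in ground_hcomp true -> v = 0.
Proof. by rewrite !inE => _ /eqP. Qed.

Definition ground_superspace : superspace K :=
  SuperSpace ground_hcomp_closed ground_hcomp_sum ground_hcomp_cap.

Definition ground_lie : lieSuperalgebra K.
Proof.
refine (@LieSuperalgebra K ground_superspace (fun _ _ => 0) _ _ _ _ _).
- by move=> x a u v; rewrite scaler0 addr0.
- by move=> x a u v; rewrite scaler0 addr0.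
- by move=> i j x y _ _; have [] := ground_hcomp_closed (i (+) j).
- by move=> i j x y _ _; rewrite scaler0 oppr0.
- by move=> i j x y z _ _; rewrite scaler0 addr0.
Defined.

End Ground.

(* U(g) is presented as the unital associative algebra generated by the vector
   space g subject to [x, y] = x y - (-1)^{|x||y|} y x for homogeneous x, y:
   formal expressions modulo the congruence generated by these relations and
   the axioms of unital associative K-algebras. *)

Inductive uterm (K : numFieldType) (g : lieSuperalgebra K) : Type :=
| UGen of g
| UZero
| UOne
| UOpp of uterm g
| UAdd of uterm g & uterm g
| UScale of K & uterm g
| UMul of uterm g & uterm g.
Arguments UZero {K g}.
Arguments UOne {K g}.

Inductive ueq (K : numFieldType) (g : lieSuperalgebra K)
    : uterm g -> uterm g -> Prop :=
| ueq_refl s : ueq s s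
| ueq_sym s t : ueq s t -> ueq t s
| ueq_trans s t u : ueq s t -> ueq t u -> ueq s u
| ueq_opp s s' : ueq s s' -> ueq (UOpp s) (UOpp s')
| ueq_add s s' t t' : ueq s s' -> ueq t t' -> ueq (UAdd s t) (UAdd s' t')
| ueq_scale a s s' : ueq s s' -> ueq (UScale a s) (UScale a s')
| ueq_mul s s' t t' : ueq s s' -> ueq t t' -> ueq (UMul s t) (UMul s' t')
| ueq_addA s t u : ueq (UAdd s (UAdd t u)) (UAdd (UAdd s t) u)
| ueq_addC s t : ueq (UAdd s t) (UAdd t s)
| ueq_add0 s : ueq (UAdd UZero s) s
| ueq_addN s : ueq (UAdd (UOpp s) s) UZero
| ueq_scaleA a b s : ueq (UScale a (UScale b s)) (UScale (a * b) s)
| ueq_scale1 s : ueq (UScale 1 s) s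
| ueq_scaleDr a s t :
    ueq (UScale a (UAdd s t)) (UAdd (UScale a s) (UScale a t))
| ueq_scaleDl s a b :
    ueq (UScale (a + b) s) (UAdd (UScale a s) (UScale b s))
| ueq_mulA s t u : ueq (UMul s (UMul t u)) (UMul (UMul s t) u)
| ueq_mul1l s : ueq (UMul UOne s) s
| ueq_mul1r s : ueq (UMul s UOne) s
| ueq_mulDl s t u : ueq (UMul (UAdd s t) u) (UAdd (UMul s u) (UMul t u))
| ueq_mulDr s t u : ueq (UMul s (UAdd t u)) (UAdd (UMul s t) (UMul s u))
| ueq_scaleAl a s t : ueq (UScale a (UMul s t)) (UMul (UScale a s) t)
| ueq_scaleAr a s t : ueq (UScale a (UMul s t)) (UMul s (UScale a t))
| ueq_lin a (x y : g) :
    ueq (UGen (a *: x + y)) (UAdd (UScale a (UGen x)) (UGen y))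
| ueq_br i j (x y : g) : x \in hcomp g i -> y \in hcomp g j ->
    ueq (UGen (br x y))
        (UAdd (UMul (UGen x) (UGen y))
              (UOpp (UScale (ssign K i j) (UMul (UGen y) (UGen x))))).

Section Enveloping.
Variables (K : numFieldType) (g : lieSuperalgebra K).

HB.instance Definition _ := gen_eqMixin (uterm g).
HB.instance Definition _ := gen_choiceMixin (uterm g).

Definition ueqb (s t : uterm g) : bool := `[< ueq s t >].

Lemma ueqb_refl : reflexive ueqb.
Proof. by move=> s; apply/asboolP; exact: ueq_refl. Qed.

Lemma ueqb_sym : symmetric ueqb.
Proof.
by move=> s t; apply/idP/idP => /asboolP h; apply/asboolP; exact: ueq_sym.
Qed.

Lemma ueqb_trans : transitive ueqb.
Proof.
by move=> t s u /asboolP h /asboolP k; apply/asboolP; exact: ueq_trans k.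
Qed.

Definition ueq_equiv : equiv_rel (uterm g) :=
  EquivRel ueqb ueqb_refl ueqb_sym ueqb_trans.

Definition uenv : Type := {eq_quot ueq_equiv}.
HB.instance Definition _ := Choice.on uenv.

Definition upi (t : uterm g) : uenv := \pi_({eq_quot ueq_equiv}) t.
Definition urepr (u : uenv) : uterm g := repr (u : {eq_quot ueq_equiv}).

Lemma upiP s t : upi s = upi t <-> ueq s t.
Proof.
split; first by move=> /eqmodP /asboolP.
by move=> h; apply/eqmodP/asboolP.
Qed.

Lemma ureprK u : upi (urepr u) = u.
Proof. exact: reprK. Qed.

Lemma urepr_upi t : ueq (urepr (upi t)) t.
Proof. by apply/upiP; rewrite ureprK. Qed.

Definition u0 := upi UZero.
Definition u1 := upi UOne.
Definition uopp u := upi (UOpp (urepr u)).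
Definition uadd u v := upi (UAdd (urepr u) (urepr v)).
Definition uscale a u := upi (UScale a (urepr u)).
Definition umul u v := upi (UMul (urepr u) (urepr v)).

Lemma upi_opp s : upi (UOpp s) = uopp (upi s).
Proof. apply/upiP/ueq_opp/ueq_sym; exact: urepr_upi. Qed.
Lemma upi_add s t : upi (UAdd s t) = uadd (upi s) (upi t).
Proof. by apply/upiP/ueq_add; apply/ueq_sym; exact: urepr_upi. Qed.
Lemma upi_scale a s : upi (UScale a s) = uscale a (upi s).
Proof. apply/upiP/ueq_scale/ueq_sym; exact: urepr_upi. Qed.
Lemma upi_mul s t : upi (UMul s t) = umul (upi s) (upi t).
Proof. by apply/upiP/ueq_mul; apply/ueq_sym; exact: urepr_upi. Qed.

Lemma uind (P : uenv -> Prop) : (forall t, P (upi t)) -> forall u, P u.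
Proof. by move=> h u; rewrite -[u]ureprK. Qed.

Lemma uaddA : associative uadd.
Proof.
elim/uind=> s; elim/uind=> t; elim/uind=> u.
by rewrite -!upi_add; apply/upiP; exact: ueq_addA.
Qed.
Lemma uaddC : commutative uadd.
Proof.
by elim/uind=> s; elim/uind=> t; rewrite -!upi_add; apply/upiP; exact: ueq_addC.
Qed.
Lemma uadd0 : left_id u0 uadd.
Proof. by elim/uind=> s; rewrite -!upi_add; apply/upiP; exact: ueq_add0. Qed.
Lemma uaddN : left_inverse u0 uopp uadd.
Proof.
by elim/uind=> s; rewrite -upi_opp -!upi_add; apply/upiP; exact: ueq_addN.
Qed.

HB.instance Definition _ := GRing.isZmodule.Build uenv uaddA uaddC uadd0 uaddN.

Lemma umulA : associative umul.
Proof.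
elim/uind=> s; elim/uind=> t; elim/uind=> u.
by rewrite -!upi_mul; apply/upiP; exact: ueq_mulA.
Qed.
Lemma umul1l : left_id u1 umul.
Proof. by elim/uind=> s; rewrite -!upi_mul; apply/upiP; exact: ueq_mul1l. Qed.
Lemma umul1r : right_id u1 umul.
Proof. by elim/uind=> s; rewrite -!upi_mul; apply/upiP; exact: ueq_mul1r. Qed.
Lemma umulDl : left_distributive umul uadd.
Proof.
elim/uind=> s; elim/uind=> t; elim/uind=> u.
by rewrite -!(upi_mul, upi_add); apply/upiP; exact: ueq_mulDl.
Qed.
Lemma umulDr : right_distributive umul uadd.
Proof.
elim/uind=> s; elim/uind=> t; elim/uind=> u.
by rewrite -!(upi_mul, upi_add); apply/upiP; exact: ueq_mulDr.
Qed.

End Enveloping.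

Section Eval.
Variables (K : numFieldType) (g : lieSuperalgebra K) (A : algType K) (f : g -> A).

Fixpoint ueval (t : uterm g) : A :=
  match t with
  | UGen x => f x
  | UZero => 0
  | UOne => 1
  | UOpp s => - ueval s
  | UAdd s t => ueval s + ueval t
  | UScale a s => a *: ueval s
  | UMul s t => ueval s * ueval t
  end.

Hypothesis f_lin : linear f.
Hypothesis f_br : forall i j x y, x \in hcomp g i -> y \in hcomp g j ->
  f (br x y) = f x * f y - ssign K i j *: (f y * f x).

Lemma ueval_eq s t : ueq s t -> ueval s = ueval t.
Proof.
elim=> {s t} //=.
- by move=> s t u _ -> _ ->.
- by move=> s s' _ ->.
- by move=> s s' t t' _ -> _ ->.
- by move=> a s s' _ ->.
- by move=> s s' t t' _ -> _ ->.
- by move=> s t u; rewrite addrA.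
- by move=> s t; rewrite addrC.
- by move=> s; rewrite add0r.
- by move=> s; rewrite addNr.
- by move=> a b s; rewrite scalerA.
- by move=> s; rewrite scale1r.
- by move=> a s t; rewrite scalerDr.
- by move=> s a b; rewrite scalerDl.
- by move=> s t u; rewrite mulrA.
- by move=> s; rewrite mul1r.
- by move=> s; rewrite mulr1.
- by move=> s t u; rewrite mulrDl.
- by move=> s t u; rewrite mulrDr.
- by move=> a s t; rewrite scalerAl.
- by move=> a s t; rewrite scalerAr.
Qed.

End Eval.

Section EnvelopingAlg.
Variables (K : numFieldType) (g : lieSuperalgebra K).

Lemma u1_neq0 : @u1 K g != 0.
Proof.
apply/eqP => /upiP h.
have lin0 : linear ((fun=> 0) : g -> K^o) by move=> a u v; rewrite scaler0 addr0.
have := ueval_eq lin0 _ h => /= e.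
have /eqP : 1 = 0 :> K^o by apply: e => *; rewrite mul0r scaler0 subr0.
by rewrite oner_eq0.
Qed.

HB.instance Definition _ := GRing.Zmodule_isNzRing.Build (uenv g)
  (@umulA K g) (@umul1l K g) (@umul1r K g) (@umulDl K g) (@umulDr K g) u1_neq0.

Lemma uscaleA a b (u : uenv g) : uscale a (uscale b u) = uscale (a * b) u.
Proof.
by elim/uind: u => s; rewrite -!upi_scale; apply/upiP; exact: ueq_scaleA.
Qed.
Lemma uscale1 : left_id 1 (@uscale K g).
Proof. by elim/uind=> s; rewrite -!upi_scale; apply/upiP; exact: ueq_scale1. Qed.
Lemma uscaleDr : right_distributive (@uscale K g) (@uadd K g).
Proof.
move=> a; elim/uind=> s; elim/uind=> t.
by rewrite -!(upi_scale, upi_add); apply/upiP; exact: ueq_scaleDr.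
Qed.
Lemma uscaleDl (u : uenv g) : {morph (@uscale K g)^~ u : a b / a + b >-> uadd a b}.
Proof.
elim/uind: u => s a b.
by rewrite -!(upi_scale, upi_add); apply/upiP; exact: ueq_scaleDl.
Qed.

HB.instance Definition _ := GRing.Zmodule_isLmodule.Build K (uenv g)
  uscaleA uscale1 uscaleDr uscaleDl.

Lemma uscaleAl (a : K) (u v : uenv g) : a *: (u * v) = (a *: u) * v.
Proof.
elim/uind: u => s; elim/uind: v => t.
rewrite -[LHS]/(uscale a (umul _ _)) -[RHS]/(umul (uscale a _) _).
by rewrite -!(upi_scale, upi_mul); apply/upiP; exact: ueq_scaleAl.
Qed.
HB.instance Definition _ := GRing.Lmodule_isLalgebra.Build K (uenv g) uscaleAl.

Lemma uscaleAr (a : K) (u v : uenv g) : a *: (u * v) = u * (a *: v).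
Proof.
elim/uind: u => s; elim/uind: v => t.
rewrite -[LHS]/(uscale a (umul _ _)) -[RHS]/(umul _ (uscale a _)).
by rewrite -!(upi_scale, upi_mul); apply/upiP; exact: ueq_scaleAr.
Qed.
HB.instance Definition _ := GRing.Lalgebra_isAlgebra.Build K (uenv g) uscaleAr.

Lemma upiN (s : uterm g) : upi (UOpp s) = - upi s.
Proof. exact: upi_opp. Qed.
Lemma upiD (s t : uterm g) : upi (UAdd s t) = upi s + upi t.
Proof. exact: upi_add. Qed.
Lemma upiZ a (s : uterm g) : upi (UScale a s) = a *: upi s.
Proof. exact: upi_scale. Qed.
Lemma upiM (s t : uterm g) : upi (UMul s t) = upi s * upi t.
Proof. exact: upi_mul. Qed.

Definition uiota (x : g) : uenv g := upi (UGen x).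

Lemma uiota_lin : linear uiota.
Proof.
by move=> a x y; rewrite -upiZ -upiD; apply/upiP; exact: ueq_lin.
Qed.

Lemma uiota_br i j x y : x \in hcomp g i -> y \in hcomp g j ->
  uiota (br x y) = uiota x * uiota y - ssign K i j *: (uiota y * uiota x).
Proof.
move=> hx hy; rewrite -!upiM -upiZ -upiN.
by rewrite -upiD; apply/upiP; exact: ueq_br.
Qed.

End EnvelopingAlg.

Section Span.
Variables (K : numFieldType) (V : lmodType K).

Lemma span_of_closed (S : V -> Prop) : submod_closed (span_of S).
Proof.
split; first by apply/asboolP => N [].
move=> a u v /asboolP hu /asboolP hv; apply/asboolP => N cN hS.
by have [_ lN] := cN; apply: lN; [exact: hu | exact: hv].
Qed.

Lemma span_of_gen (S : V -> Prop) s : S s -> s \in span_of S.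
Proof. by move=> Ss; apply/asboolP => N _; exact. Qed.

Lemma span_of_ind (S : V -> Prop) (P : V -> Prop) :
  P 0 -> (forall a u v, P u -> P v -> P (a *: u + v)) ->
  (forall s, S s -> P s) -> forall v, v \in span_of S -> P v.
Proof.
move=> P0 PL PS v /asboolP /(_ [pred w | `[< P w >]]) h; apply/asboolP.
apply: h; last by move=> s /PS h; apply/asboolP.
split; first exact/asboolP.
by move=> a u w /asboolP hu /asboolP hw; apply/asboolP; exact: PL.
Qed.

Lemma submodD (N : {pred V}) u v :
  submod_closed N -> u \in N -> v \in N -> u + v \in N.
Proof. by move=> [_ h] hu hv; rewrite -[u]scale1r; exact: h. Qed.

Lemma submodZ (N : {pred V}) a u : submod_closed N -> u \in N -> a *: u \in N.
Proof. by move=> [h0 h] hu; rewrite -[_ *: _]addr0; exact: h. Qed.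

Lemma submodN (N : {pred V}) u : submod_closed N -> u \in N -> - u \in N.
Proof. by move=> cN hu; rewrite -scaleN1r; exact: submodZ. Qed.

End Span.

Section LinearFacts.
Variables (K : numFieldType) (U V : lmodType K) (f : U -> V).
Hypothesis f_lin : linear f.

Lemma lin0 : f 0 = 0.
Proof.
by have := f_lin (-1) 0 0; rewrite scaler0 addr0 scaleN1r addNr.
Qed.
Lemma linD u v : f (u + v) = f u + f v.
Proof. by rewrite -[u]scale1r f_lin !scale1r. Qed.
Lemma linZ a u : f (a *: u) = a *: f u.
Proof. by rewrite -[a *: u]addr0 f_lin lin0 addr0. Qed.
Lemma linN u : f (- u) = - f u.
Proof. by rewrite -scaleN1r linZ scaleN1r. Qed.

End LinearFacts.

Section Parity.
Variables (K : numFieldType) (V : superspace K).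

Lemma hcomp_ex v : exists w : V * V,
  [/\ w.1 \in hcomp V false, w.2 \in hcomp V true & v = w.1 + w.2].
Proof. by have [v0 [v1 h]] := hcomp_sum v; exists (v0, v1). Qed.

Definition spar (v : V) : V :=
  let w := projT1 (cid (hcomp_ex v)) in w.1 - w.2.

Lemma sparE v0 v1 : v0 \in hcomp V false -> v1 \in hcomp V true ->
  spar (v0 + v1) = v0 - v1.
Proof.
move=> h0 h1; rewrite /spar; case: cid => -[w0 w1] /= [k0 k1 e].
have c0 := hcomp_closed V false; have c1 := hcomp_closed V true.
have e0 : v0 - w0 = w1 - v1.
  by apply/eqP; rewrite subr_eq addrAC eq_sym subr_eq eq_sym [w1 + _]addrC e.
have z : v0 - w0 = 0.
  apply: hcomp_cap; first by apply: submodD => //; exact: submodN.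
  by rewrite e0; apply: submodD => //; exact: submodN.
have /eqP := z; rewrite subr_eq0 => /eqP <-.
by have /eqP := z; rewrite e0 subr_eq0 => /eqP <-.
Qed.

Lemma spar_hom i v : v \in hcomp V i -> spar v = (-1) ^+ i *: v.
Proof.
have [z0 _] := hcomp_closed V false; have [z1 _] := hcomp_closed V true.
case: i => h; first by rewrite -[v in LHS]add0r sparE // sub0r scaleN1r.
by rewrite -[v in LHS]addr0 sparE // subr0 scale1r.
Qed.

Lemma spar_lin : linear spar.
Proof.
have c0 := hcomp_closed V false; have c1 := hcomp_closed V true.
move=> a u v; have [u0 [u1 [hu0 hu1 ->]]] := hcomp_sum u.
have [v0 [v1 [hv0 hv1 ->]]] := hcomp_sum v.
rewrite scalerDr addrACA !sparE //; last 2 first.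
- by apply: submodD => //; exact: submodZ.
- by apply: submodD => //; exact: submodZ.
by rewrite scalerDr scalerN opprD addrACA.
Qed.

End Parity.

Lemma sign_cap (K : numFieldType) (V : lmodType K) (v : V) : v = - v -> v = 0.
Proof.
move=> /eqP; rewrite -addr_eq0 -mulr2n -scaler_nat scaler_eq0.
by rewrite pnatr_eq0 => /eqP.
Qed.

Section UMap.
Variables (K : numFieldType) (g : lieSuperalgebra K) (A : algType K) (f : g -> A).
Hypothesis f_lin : linear f.
Hypothesis f_br : forall i j x y, x \in hcomp g i -> y \in hcomp g j ->
  f (br x y) = f x * f y - ssign K i j *: (f y * f x).

Definition ulift (u : uenv g) : A := ueval f (urepr u).

Lemma ulift_pi t : ulift (upi t) = ueval f t.
Proof. by apply: (ueval_eq f_lin f_br); exact: urepr_upi. Qed.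

Lemma ulift_iota x : ulift (uiota x) = f x.
Proof. exact: ulift_pi. Qed.
Lemma ulift1 : ulift 1 = 1.
Proof. exact: (ulift_pi UOne). Qed.
Lemma uliftM u v : ulift (u * v) = ulift u * ulift v.
Proof.
elim/uind: u => s; elim/uind: v => t.
by rewrite -upiM !ulift_pi.
Qed.
Lemma ulift_lin : linear ulift.
Proof.
move=> a; elim/uind => s; elim/uind => t.
by rewrite -upiZ -upiD !ulift_pi.
Qed.

Lemma ulift_unique (h : uenv g -> A) : linear h -> h 1 = 1 ->
  {morph h : u v / u * v} -> (forall x, h (uiota x) = f x) -> h =1 ulift.
Proof.
move=> hl h1 hM hi; elim/uind => t; rewrite ulift_pi.
elim: t => [x|||s hs|s hs t ht|a s hs|s hs t ht] //=.
- exact: hi.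
- exact: (lin0 hl).
- by rewrite upiN (linN hl) hs.
- by rewrite upiD (linD hl) hs ht.
- by rewrite upiZ (linZ hl) hs.
- by rewrite upiM hM hs ht.
Qed.

End UMap.

Section UGrading.
Variables (K : numFieldType) (g : lieSuperalgebra K).

(* Products of homogeneous elements of g, with their total parity. *)
Inductive umonomial : bool -> uenv g -> Prop :=
| umon_one : umonomial false 1
| umon_mul i j x u : x \in hcomp g i -> umonomial j u ->
    umonomial (i (+) j) (uiota x * u).

Definition uhcomp (i : bool) : {pred uenv g} := span_of (umonomial i).

Lemma umonomialM i j u v :
  umonomial i u -> umonomial j v -> umonomial (i (+) j) (u * v).
Proof.
move=> hu hv; elim: {i u}hu => [|i k x u hx _ IH]; first by rewrite mul1r.
by rewrite -mulrA -addbA; exact: umon_mul.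
Qed.

Lemma uhcompM i j u v :
  u \in uhcomp i -> v \in uhcomp j -> u * v \in uhcomp (i (+) j).
Proof.
have c := span_of_closed (umonomial (i (+) j)).
move=> hu hv; move: u hu; apply: span_of_ind.
- by rewrite mul0r; case: c.
- by move=> a u w hu hw; rewrite mulrDl -scalerAl; case: c => _; exact.
move=> u hu; move: v hv; apply: span_of_ind.
- by rewrite mulr0; case: c.
- by move=> a w v hw hv; rewrite mulrDr -scalerAr; case: c => _; exact.
by move=> v hv; apply: span_of_gen; exact: umonomialM.
Qed.

Lemma uhcomp_one : 1 \in uhcomp false.
Proof. by apply: span_of_gen; exact: umon_one. Qed.

Lemma uhcomp_iota i x : x \in hcomp g i -> uiota x \in uhcomp i.
Proof.
move=> hx; apply: span_of_gen; rewrite -[uiota x]mulr1 -(addbF i).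
by apply: umon_mul => //; exact: umon_one.
Qed.

Lemma uhcomp_sum u : exists u0 u1,
  [/\ u0 \in uhcomp false, u1 \in uhcomp true & u = u0 + u1].
Proof.
have c0 := span_of_closed (umonomial false).
have c1 := span_of_closed (umonomial true).
elim/uind: u; elim=> [x|||s|s hs t|a s|s hs t].
- have [x0 [x1 [h0 h1 ->]]] := hcomp_sum x.
  exists (uiota x0), (uiota x1); split; try exact: uhcomp_iota.
  exact: (linD (@uiota_lin K g)).
- exists 0, 0; rewrite addr0; split=> //; first by case: c0.
  by case: c1.
- exists 1, 0; rewrite addr0; split=> //; first exact: uhcomp_one.
  by case: c1.
- move=> [u [v [hu hv e]]]; exists (- u), (- v).
  by rewrite !submodN // upiN e -opprD.
- move: hs => [u [v [hu hv e]]] [u' [v' [hu' hv' e']]]; exists (u + u'), (v + v').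
  by rewrite !submodD // upiD e e' addrACA.
- move=> [u [v [hu hv e]]]; exists (a *: u), (a *: v).
  by rewrite !submodZ // upiZ e -scalerDr.
- move: hs => [u [v [hu hv e]]] [u' [v' [hu' hv' e']]].
  exists (u * u' + v * v'), (u * v' + v * u'); split.
  + by apply: submodD => //; [exact: uhcompM hu hu' | exact: uhcompM hv hv'].
  + by apply: submodD => //; [exact: uhcompM hu hv' | exact: uhcompM hv hu'].
  rewrite upiM e e'.
  by rewrite mulrDl !mulrDr [v * u' + _]addrC addrACA.
Qed.

Definition upar_gen (x : g) : uenv g := uiota (spar x).

Lemma upar_gen_lin : linear upar_gen.
Proof. by move=> a x y; rewrite /upar_gen spar_lin uiota_lin. Qed.

Lemma upar_gen_br i j x y : x \in hcomp g i -> y \in hcomp g j ->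
  upar_gen (br x y) =
  upar_gen x * upar_gen y - ssign K i j *: (upar_gen y * upar_gen x).
Proof.
move=> hx hy; rewrite /upar_gen (spar_hom hx) (spar_hom hy).
rewrite (spar_hom (br_hom hx hy)) !(linZ (@uiota_lin K g)) (uiota_br hx hy).
rewrite -!scalerAl -!scalerAr !scalerA signr_addb scalerBr !scalerA.
congr (_ - _); congr (_ *: _).
by rewrite mulrC -[RHS]mulrA; congr (_ * _); rewrite mulrC.
Qed.

Definition upar : uenv g -> uenv g := ulift upar_gen.

Lemma upar_lin : linear upar.
Proof. exact: (ulift_lin upar_gen_lin upar_gen_br). Qed.
Lemma uparM u v : upar (u * v) = upar u * upar v.
Proof. exact: (uliftM upar_gen_lin upar_gen_br). Qed.
Lemma upar1 : upar 1 = 1.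
Proof. exact: (ulift1 upar_gen_lin upar_gen_br). Qed.
Lemma upar_iota x : upar (uiota x) = uiota (spar x).
Proof. exact: (ulift_iota upar_gen_lin upar_gen_br). Qed.

Lemma upar_hom i u : u \in uhcomp i -> upar u = (-1) ^+ i *: u.
Proof.
move: u; apply: span_of_ind.
- by rewrite (lin0 upar_lin) scaler0.
- by move=> a u v hu hv; rewrite upar_lin hu hv scalerDr !scalerA mulrC.
move=> u; elim=> [|{}i j x {}u hx _ IH]; first by rewrite upar1 scale1r.
rewrite uparM upar_iota (spar_hom hx) (linZ (@uiota_lin K g)) IH.
by rewrite -scalerAl -scalerAr scalerA signr_addb.
Qed.

End UGrading.
Arguments uhcomp {K} g i.

Section UFunctor.
Variables (K : numFieldType) (h g : lieSuperalgebra K) (f : lieHom h g).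

Definition umap_gen (x : h) : uenv g := uiota (f x).

Lemma umap_gen_lin : linear umap_gen.
Proof. by move=> a x y; rewrite /umap_gen lh_lin uiota_lin. Qed.

Lemma umap_gen_br i j x y : x \in hcomp h i -> y \in hcomp h j ->
  umap_gen (br x y) =
  umap_gen x * umap_gen y - ssign K i j *: (umap_gen y * umap_gen x).
Proof.
move=> hx hy; rewrite /umap_gen lh_br.
by apply: uiota_br; exact: lh_hom.
Qed.

Definition umap : uenv h -> uenv g := ulift umap_gen.

Lemma umap_lin : linear umap.
Proof. exact: (ulift_lin umap_gen_lin umap_gen_br). Qed.
Lemma umapM u v : umap (u * v) = umap u * umap v.
Proof. exact: (uliftM umap_gen_lin umap_gen_br). Qed.
Lemma umap1 : umap 1 = 1.
Proof. exact: (ulift1 umap_gen_lin umap_gen_br). Qed.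
Lemma umap_iota x : umap (uiota x) = uiota (f x).
Proof. exact: (ulift_iota umap_gen_lin umap_gen_br). Qed.

Lemma lh_spar x : f (spar x) = spar (f x).
Proof.
have [x0 [x1 [h0 h1 ->]]] := hcomp_sum x.
rewrite sparE // (linD (lh_lin f)) (linD (lh_lin f)) (linN (lh_lin f)).
by rewrite sparE //; exact: lh_hom.
Qed.

Lemma umap_upar u : umap (upar u) = upar (umap u).
Proof.
elim/uind: u; elim=> [x|||s hs|s hs t ht|a s hs|s hs t ht].
- rewrite -[upi _]/(uiota x) upar_iota !umap_iota upar_iota; congr uiota.
  exact: lh_spar.
- by rewrite -[upi _]/(0 : uenv h) (lin0 (@upar_lin _ _)) !(lin0 umap_lin) (lin0 (@upar_lin _ _)).
- by rewrite -[upi _]/(1 : uenv h) upar1 !umap1 upar1.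
- rewrite upiN (linN (@upar_lin _ _)).
  by rewrite !(linN umap_lin) (linN (@upar_lin _ _)) hs.
- rewrite upiD (linD (@upar_lin _ _)).
  by rewrite !(linD umap_lin) (linD (@upar_lin _ _)) hs ht.
- rewrite upiZ (linZ (@upar_lin _ _)).
  by rewrite !(linZ umap_lin) (linZ (@upar_lin _ _)) hs.
- rewrite upiM.
  by rewrite !(uparM, umapM) hs ht.
Qed.

End UFunctor.

Section UAction.
Variables (K : numFieldType) (g : lieSuperalgebra K) (M : supermodule g).

Fixpoint utact (t : uterm g) (m : M) : M :=
  match t with
  | UGen x => sact x m
  | UZero => 0
  | UOne => m
  | UOpp s => - utact s m
  | UAdd s t => utact s m + utact t m
  | UScale a s => a *: utact s m
  | UMul s t => utact s (utact t m)
  end.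

Lemma utact_lin t : linear (utact t).
Proof.
elim: t => [x|||s hs|s hs t ht|b s hs|s hs t ht] a m n //=.
- exact: sact_linr.
- by rewrite scaler0 addr0.
- by rewrite hs scalerN opprD.
- by rewrite hs ht scalerDr addrACA.
- by rewrite hs scalerDr !scalerA mulrC.
- by rewrite ht hs.
Qed.

Lemma utact_eq s t : ueq s t -> utact s =1 utact t.
Proof.
elim=> {s t} //=.
- by move=> s t _ h m; rewrite h.
- by move=> s t u _ h _ k m; rewrite h k.
- by move=> s s' _ h m; rewrite h.
- by move=> s s' t t' _ h _ k m; rewrite h k.
- by move=> a s s' _ h m; rewrite h.
- by move=> s s' t t' _ h _ k m; rewrite h k.
- by move=> s t u m; rewrite addrA.
- by move=> s t m; rewrite addrC.
- by move=> s m; rewrite add0r.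
- by move=> s m; rewrite addNr.
- by move=> a b s m; rewrite scalerA.
- by move=> s m; rewrite scale1r.
- by move=> a s t m; rewrite scalerDr.
- by move=> s a b m; rewrite scalerDl.
- by move=> s t u m; rewrite (linD (utact_lin s)).
- by move=> a s t m; rewrite (linZ (utact_lin s)).
- by move=> a x y m; exact: (sact_linl m).
- by move=> i j x y hx hy m; exact: sact_br.
Qed.

Definition uact (u : uenv g) (m : M) : M := utact (urepr u) m.

Lemma uact_pi t m : uact (upi t) m = utact t m.
Proof. by apply: utact_eq; exact: urepr_upi. Qed.

Lemma uact_linr u : linear (uact u).
Proof. exact: utact_lin. Qed.
Lemma uact_linl m : linear (uact^~ m).
Proof.
move=> a; elim/uind => s; elim/uind => t.
by rewrite -upiZ -upiD !uact_pi.
Qed.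
Lemma uact1 m : uact 1 m = m.
Proof. exact: (uact_pi UOne). Qed.
Lemma uactM u v m : uact (u * v) m = uact u (uact v m).
Proof.
by elim/uind: u => s; elim/uind: v => t; rewrite -upiM !uact_pi.
Qed.
Lemma uact_iota x m : uact (uiota x) m = sact x m.
Proof. exact: uact_pi. Qed.

Lemma sact_spar x m : spar (sact x m : M) = sact (spar x) (spar m).
Proof.
have [x0 [x1 [h0 h1 ->]]] := hcomp_sum x.
have [m0 [m1 [k0 k1 ->]]] := hcomp_sum m.
have L := (linD (@spar_lin K M)); have N z := linN (sact_linl z).
have Dl z := linD (sact_linl z); have Dr z := linD (@sact_linr K g M z).
have Nr z := linN (@sact_linr K g M z).
rewrite !sparE // !(Dl, Dr, N, Nr, L) /=.
rewrite (spar_hom (sact_hom h0 k0)) (spar_hom (sact_hom h0 k1)).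
rewrite (spar_hom (sact_hom h1 k0)) (spar_hom (sact_hom h1 k1)).
by rewrite /= !scale1r !scaleN1r opprK.
Qed.

Lemma uact_spar u m : spar (uact u m) = uact (upar u) (spar m).
Proof.
have Z := linZ (@spar_lin K M); have N := linN (@spar_lin K M).
have D := linD (@spar_lin K M).
elim/uind: u m; elim=> [x|||s hs|s hs t ht|a s hs|s hs t ht] m.
- by rewrite -[upi _]/(uiota x) upar_iota !uact_iota sact_spar.
- rewrite -[upi _]/(0 : uenv g) (lin0 (@upar_lin _ _)) !(lin0 (@uact_linl _)).
  exact: (lin0 (@spar_lin K M)).
- by rewrite -[upi _]/(1 : uenv g) upar1 !uact1.
- rewrite upiN (linN (@upar_lin _ _)).
  by rewrite !(linN (@uact_linl _)) N hs.
- rewrite upiD (linD (@upar_lin _ _)).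
  by rewrite !(linD (@uact_linl _)) D hs ht.
- rewrite upiZ (linZ (@upar_lin _ _)).
  by rewrite !(linZ (@uact_linl _)) Z hs.
- rewrite upiM.
  by rewrite uparM !uactM hs ht.
Qed.

End UAction.

(* For a map j : A -> B and an action of A on M, [tensor j act] is B (x)_A M:
   the abelian group generated by the symbols b (x) m, subject to
   biadditivity and to (b * j a) (x) m = b (x) (a m). *)

Inductive tterm (B M : Type) : Type :=
| TPure of B & M
| TZero
| TOpp of tterm B M
| TAdd of tterm B M & tterm B M.
Arguments TZero {B M}.

Inductive teq (A : Type) (B : pzRingType) (M : zmodType) (j : A -> B)
    (act : A -> M -> M) : tterm B M -> tterm B M -> Prop :=
| teq_refl s : teq j act s s
| teq_sym s t : teq j act s t -> teq j act t s
| teq_trans s t u : teq j act s t -> teq j act t u -> teq j act s u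
| teq_opp s s' : teq j act s s' -> teq j act (TOpp s) (TOpp s')
| teq_add s s' t t' : teq j act s s' -> teq j act t t' ->
    teq j act (TAdd s t) (TAdd s' t')
| teq_addA s t u : teq j act (TAdd s (TAdd t u)) (TAdd (TAdd s t) u)
| teq_addC s t : teq j act (TAdd s t) (TAdd t s)
| teq_add0 s : teq j act (TAdd TZero s) s
| teq_addN s : teq j act (TAdd (TOpp s) s) TZero
| teq_pureDl b c m :
    teq j act (TPure (b + c) m) (TAdd (TPure b m) (TPure c m))
| teq_pureDr b m n :
    teq j act (TPure b (m + n)) (TAdd (TPure b m) (TPure b n))
| teq_pureA b a m : teq j act (TPure (b * j a) m) (TPure b (act a m)).

Section Tensor.
Variables (K : numFieldType) (A : Type) (B : algType K) (M : zmodType).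
Variables (j : A -> B) (act : A -> M -> M).

HB.instance Definition _ := gen_eqMixin (tterm B M).
HB.instance Definition _ := gen_choiceMixin (tterm B M).

Definition teqb (s t : tterm B M) : bool := `[< teq j act s t >].

Lemma teqb_refl : reflexive teqb.
Proof. by move=> s; apply/asboolP; exact: teq_refl. Qed.

Lemma teqb_sym : symmetric teqb.
Proof.
by move=> s t; apply/idP/idP => /asboolP h; apply/asboolP; exact: teq_sym.
Qed.

Lemma teqb_trans : transitive teqb.
Proof.
by move=> t s u /asboolP h /asboolP k; apply/asboolP; exact: teq_trans k.
Qed.

Definition teq_equiv : equiv_rel (tterm B M) :=
  EquivRel teqb teqb_refl teqb_sym teqb_trans.

Definition tensor : Type := {eq_quot teq_equiv}.
HB.instance Definition _ := Choice.on tensor.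

Definition tpi (t : tterm B M) : tensor := \pi_({eq_quot teq_equiv}) t.
Definition trepr (u : tensor) : tterm B M := repr (u : {eq_quot teq_equiv}).

Lemma tpiP s t : tpi s = tpi t <-> teq j act s t.
Proof.
split; first by move=> /eqmodP /asboolP.
by move=> h; apply/eqmodP/asboolP.
Qed.

Lemma treprK u : tpi (trepr u) = u.
Proof. exact: reprK. Qed.

Lemma trepr_tpi t : teq j act (trepr (tpi t)) t.
Proof. by apply/tpiP; rewrite treprK. Qed.

Definition t0 := tpi TZero.
Definition topp u := tpi (TOpp (trepr u)).
Definition tadd u v := tpi (TAdd (trepr u) (trepr v)).

Lemma tpi_opp s : tpi (TOpp s) = topp (tpi s).
Proof. apply/tpiP/teq_opp/teq_sym; exact: trepr_tpi. Qed.
Lemma tpi_add s t : tpi (TAdd s t) = tadd (tpi s) (tpi t).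
Proof. by apply/tpiP/teq_add; apply/teq_sym; exact: trepr_tpi. Qed.

Lemma tind (P : tensor -> Prop) : (forall t, P (tpi t)) -> forall u, P u.
Proof. by move=> h u; rewrite -[u]treprK. Qed.

Lemma taddA : associative tadd.
Proof.
elim/tind=> s; elim/tind=> t; elim/tind=> u.
by rewrite -!tpi_add; apply/tpiP; exact: teq_addA.
Qed.
Lemma taddC : commutative tadd.
Proof.
by elim/tind=> s; elim/tind=> t; rewrite -!tpi_add; apply/tpiP; exact: teq_addC.
Qed.
Lemma tadd0 : left_id t0 tadd.
Proof. by elim/tind=> s; rewrite -!tpi_add; apply/tpiP; exact: teq_add0. Qed.
Lemma taddN : left_inverse t0 topp tadd.
Proof.
by elim/tind=> s; rewrite -tpi_opp -!tpi_add; apply/tpiP; exact: teq_addN.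
Qed.

HB.instance Definition _ :=
  GRing.isZmodule.Build tensor taddA taddC tadd0 taddN.

Definition pure (b : B) (m : M) : tensor := tpi (TPure b m).

Lemma pureDl b c m : pure (b + c) m = pure b m + pure c m.
Proof. by rewrite -[_ + pure _ _]tpi_add; apply/tpiP; exact: teq_pureDl. Qed.
Lemma pureDr b m n : pure b (m + n) = pure b m + pure b n.
Proof. by rewrite -[pure _ _ + _]tpi_add; apply/tpiP; exact: teq_pureDr. Qed.
Lemma pureA b a m : pure (b * j a) m = pure b (act a m).
Proof. by apply/tpiP; exact: teq_pureA. Qed.

Lemma tensor_ind (P : tensor -> Prop) : P 0 -> (forall u, P u -> P (- u)) ->
  (forall u v, P u -> P v -> P (u + v)) -> (forall b m, P (pure b m)) ->
  forall u, P u.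
Proof.
move=> h0 hN hD hp; elim/tind; elim=> [b m||s hs|s hs t ht].
- exact: hp.
- exact: h0.
- by rewrite tpi_opp; exact: hN.
by rewrite tpi_add; exact: hD.
Qed.

Section Lift.
Variables (V : zmodType) (f : B -> M -> V).
Hypothesis fDl : forall b c m, f (b + c) m = f b m + f c m.
Hypothesis fDr : forall b m n, f b (m + n) = f b m + f b n.
Hypothesis fA : forall b a m, f (b * j a) m = f b (act a m).

Fixpoint teval (t : tterm B M) : V :=
  match t with
  | TPure b m => f b m
  | TZero => 0
  | TOpp s => - teval s
  | TAdd s t => teval s + teval t
  end.

Lemma teval_eq s t : teq j act s t -> teval s = teval t.
Proof.
elim=> {s t} //=.
- by move=> s t u _ -> _ ->.
- by move=> s s' _ ->.
- by move=> s s' t t' _ -> _ ->.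
- by move=> s t u; rewrite addrA.
- by move=> s t; rewrite addrC.
- by move=> s; rewrite add0r.
- by move=> s; rewrite addNr.
Qed.

Definition tlift (u : tensor) : V := teval (trepr u).

Lemma tlift_pi t : tlift (tpi t) = teval t.
Proof. by apply: teval_eq; exact: trepr_tpi. Qed.
Lemma tlift_pure b m : tlift (pure b m) = f b m.
Proof. exact: tlift_pi. Qed.
Lemma tlift0 : tlift 0 = 0.
Proof. exact: (tlift_pi TZero). Qed.
Lemma tliftN u : tlift (- u) = - tlift u.
Proof. by elim/tind: u => s; rewrite -[- _]tpi_opp !tlift_pi. Qed.
Lemma tliftD u v : tlift (u + v) = tlift u + tlift v.
Proof.
by elim/tind: u => s; elim/tind: v => t; rewrite -[_ + _]tpi_add !tlift_pi.
Qed.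

End Lift.

(* The left B-module structure: c (b (x) m) = (c b) (x) m. *)
Definition tact (c : B) : tensor -> tensor := tlift (fun b m => pure (c * b) m).

Section TAct.
Variable c : B.
Let f b m := pure (c * b) m.
Let fDl b b' m : f (b + b') m = f b m + f b' m.
Proof. by rewrite /f mulrDr pureDl. Qed.
Let fDr b m n : f b (m + n) = f b m + f b n.
Proof. by rewrite /f pureDr. Qed.
Let fA b a m : f (b * j a) m = f b (act a m).
Proof. by rewrite /f mulrA pureA. Qed.

Lemma tact_pure b m : tact c (pure b m) = pure (c * b) m.
Proof. exact: (tlift_pure fDl fDr fA). Qed.
Lemma tact0 : tact c 0 = 0.
Proof. exact: (tlift0 fDl fDr fA). Qed.
Lemma tactN u : tact c (- u) = - tact c u.
Proof. exact: (tliftN fDl fDr fA). Qed.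
Lemma tactD u v : tact c (u + v) = tact c u + tact c v.
Proof. exact: (tliftD fDl fDr fA). Qed.
End TAct.

Lemma tact_mul b c u : tact b (tact c u) = tact (b * c) u.
Proof.
elim/tensor_ind: u => [|u hu|u v hu hv|d m].
- by rewrite !tact0.
- by rewrite !tactN hu.
- by rewrite !tactD hu hv.
- by rewrite !tact_pure mulrA.
Qed.
Lemma tact_one u : tact 1 u = u.
Proof.
elim/tensor_ind: u => [|u hu|u v hu hv|d m].
- by rewrite !tact0.
- by rewrite !tactN hu.
- by rewrite !tactD hu hv.
- by rewrite !tact_pure mul1r.
Qed.
Lemma tact_addl b c u : tact (b + c) u = tact b u + tact c u.
Proof.
elim/tensor_ind: u => [|u hu|u v hu hv|d m].
- by rewrite !tact0 addr0.
- by rewrite !tactN hu opprD.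
- by rewrite !tactD hu hv addrACA.
- by rewrite !tact_pure mulrDl pureDl.
Qed.

Definition tscale (a : K) : tensor -> tensor := tact a%:A.

Lemma tscaleA a b u : tscale a (tscale b u) = tscale (a * b) u.
Proof. by rewrite /tscale tact_mul -scalerAl mul1r scalerA. Qed.
Lemma tscale1 : left_id 1 tscale.
Proof. by move=> u; rewrite /tscale scale1r tact_one. Qed.
Lemma tscaleDr : right_distributive tscale +%R.
Proof. by move=> a u v; exact: tactD. Qed.
Lemma tscaleDl u : {morph tscale^~ u : a b / a + b}.
Proof. by move=> a b; rewrite /tscale scalerDl tact_addl. Qed.

HB.instance Definition _ := GRing.Zmodule_isLmodule.Build K tensor
  tscaleA tscale1 tscaleDr tscaleDl.

Lemma tscaleE a (u : tensor) : a *: u = tact a%:A u.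
Proof. by []. Qed.

Lemma tact_linr b : linear (tact b).
Proof.
move=> a u v; rewrite tactD !tscaleE !tact_mul.
by rewrite -scalerAl -scalerAr mul1r mulr1.
Qed.
Lemma tact_linl u : linear (tact^~ u).
Proof.
move=> a b c /=; rewrite tact_addl tscaleE tact_mul.
by rewrite -scalerAl mul1r.
Qed.
Lemma pureZl a b m : pure (a *: b) m = a *: pure b m.
Proof. by rewrite tscaleE tact_pure -scalerAl mul1r. Qed.

End Tensor.

Section Induced.
Variables (K : numFieldType) (h g : lieSuperalgebra K) (f : lieHom h g).
Variable M : supermodule h.

(* U(g) (x)_{U(h)} M *)
Definition ind_space : lmodType K := tensor (umap f) (@uact K h M).

Definition ipure : uenv g -> M -> ind_space := pure (umap f) (@uact K h M).

Lemma ipureDl b c m : ipure (b + c) m = ipure b m + ipure c m.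
Proof. exact: pureDl. Qed.
Lemma ipureDr b m n : ipure b (m + n) = ipure b m + ipure b n.
Proof. exact: pureDr. Qed.
Lemma ipureA b a m : ipure (b * umap f a) m = ipure b (uact a m).
Proof. exact: pureA. Qed.
Lemma ipureZl a b m : ipure (a *: b) m = a *: ipure b m.
Proof. exact: pureZl. Qed.
Lemma ipureZr a b m : ipure b (a *: m) = a *: ipure b m.
Proof.
rewrite -[m in LHS]uact1 -(linZ (@uact_linl K h M m)) -ipureA.
by rewrite (linZ (@umap_lin K h g f)) umap1 -scalerAr mulr1 ipureZl.
Qed.
Lemma ipure0l m : ipure 0 m = 0.
Proof. by rewrite -(scale0r (0 : uenv g)) ipureZl scale0r. Qed.
Lemma ipure0r b : ipure b 0 = 0.
Proof. by rewrite -(scale0r (0 : M)) ipureZr scale0r. Qed.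

Inductive ind_hgen (i : bool) : ind_space -> Prop :=
| Ind_hgen j k u m : u \in uhcomp g j -> m \in hcomp M k -> j (+) k = i ->
    ind_hgen i (ipure u m).

Definition ind_hcomp (i : bool) : {pred ind_space} := span_of (ind_hgen i).

Lemma ind_hcomp_closed i : submod_closed (ind_hcomp i).
Proof. exact: span_of_closed. Qed.

Lemma ind_hcomp_pure j k u m : u \in uhcomp g j -> m \in hcomp M k ->
  ipure u m \in ind_hcomp (j (+) k).
Proof. by move=> hu hm; apply: span_of_gen; exact: Ind_hgen hu hm _. Qed.

Lemma ind_hcomp_sum v : exists v0 v1,
  [/\ v0 \in ind_hcomp false, v1 \in ind_hcomp true & v = v0 + v1].
Proof.
have c0 := ind_hcomp_closed false; have c1 := ind_hcomp_closed true.
elim/tensor_ind: v => [|w|w w'|b m].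
- exists 0, 0; rewrite addr0; split=> //; first by case: c0.
  by case: c1.
- by move=> [u [v [hu hv ->]]]; exists (- u), (- v); rewrite !submodN // -opprD.
- move=> [u [v [hu hv ->]]] [u' [v' [hu' hv' ->]]]; exists (u + u'), (v + v').
  by rewrite !submodD // addrACA.
have [b0 [b1 [hb0 hb1 ->]]] := uhcomp_sum b.
have [m0 [m1 [hm0 hm1 ->]]] := hcomp_sum m.
exists (ipure b0 m0 + ipure b1 m1), (ipure b0 m1 + ipure b1 m0); split.
- by apply: submodD => //;
    [exact: (ind_hcomp_pure hb0 hm0) | exact: (ind_hcomp_pure hb1 hm1)].
- by apply: submodD => //;
    [exact: (ind_hcomp_pure hb0 hm1) | exact: (ind_hcomp_pure hb1 hm0)].
rewrite -[pure _ _ _ _]/(ipure (b0 + b1) (m0 + m1)) ipureDl !ipureDr.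
by rewrite [ipure b1 m0 + _]addrC addrACA.
Qed.

Let pf (b : uenv g) (m : M) := ipure (upar b) (spar m).
Let pfDl b c m : pf (b + c) m = pf b m + pf c m.
Proof. by rewrite /pf (linD (@upar_lin K g)) ipureDl. Qed.
Let pfDr b m n : pf b (m + n) = pf b m + pf b n.
Proof. by rewrite /pf (linD (@spar_lin K M)) ipureDr. Qed.
Let pfA b a m : pf (b * umap f a) m = pf b (uact a m).
Proof. by rewrite /pf uparM -umap_upar ipureA uact_spar. Qed.

Definition ind_par : ind_space -> ind_space := tlift pf.

Lemma ind_par_pure b m : ind_par (ipure b m) = ipure (upar b) (spar m).
Proof. exact: (tlift_pure pfDl pfDr pfA). Qed.
Lemma ind_par0 : ind_par 0 = 0.
Proof. exact: (tlift0 pfDl pfDr pfA). Qed.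
Lemma ind_parN u : ind_par (- u) = - ind_par u.
Proof. exact: (tliftN pfDl pfDr pfA). Qed.
Lemma ind_parD u v : ind_par (u + v) = ind_par u + ind_par v.
Proof. exact: (tliftD pfDl pfDr pfA). Qed.
Lemma ind_parZ a u : ind_par (a *: u) = a *: ind_par u.
Proof.
elim/tensor_ind: u => [|u hu|u v hu hv|b m].
- by rewrite scaler0 ind_par0 scaler0.
- by rewrite scalerN !ind_parN hu scalerN.
- by rewrite scalerDr !ind_parD hu hv scalerDr.
rewrite -[pure _ _ _ _]/(ipure b m) -ipureZl !ind_par_pure.
by rewrite (linZ (@upar_lin K g)) ipureZl.
Qed.

Lemma ind_par_hom i v : v \in ind_hcomp i -> ind_par v = (-1) ^+ i *: v.
Proof.
move: v; apply: span_of_ind.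
- by rewrite ind_par0 scaler0.
- move=> a u v hu hv; rewrite ind_parD ind_parZ hu hv.
  by rewrite scalerDr !scalerA mulrC.
move=> _ [j k u m hu hm <-]; rewrite ind_par_pure (upar_hom hu) (spar_hom hm).
by rewrite ipureZl ipureZr scalerA signr_addb.
Qed.

Lemma ind_hcomp_cap v :
  v \in ind_hcomp false -> v \in ind_hcomp true -> v = 0.
Proof.
move=> /ind_par_hom e0 /ind_par_hom e1; apply: sign_cap.
by move: e0; rewrite e1 /= scale1r scaleN1r.
Qed.

Definition ind_superspace : superspace K :=
  SuperSpace ind_hcomp_closed ind_hcomp_sum ind_hcomp_cap.

Definition ind_act (x : g) (v : ind_superspace) : ind_superspace :=
  tact (uiota x) v.

Lemma ind_act_linr x : linear (ind_act x).
Proof. exact: tact_linr. Qed.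
Lemma ind_act_linl v : linear (ind_act^~ v).
Proof. by move=> a x y; rewrite /ind_act uiota_lin tact_linl. Qed.

Lemma ind_act_hom i j x v :
  x \in hcomp g i -> v \in hcomp ind_superspace j ->
  ind_act x v \in hcomp ind_superspace (i (+) j).
Proof.
have c := ind_hcomp_closed (i (+) j).
move=> hx; move: v; apply: span_of_ind.
- by rewrite (lin0 (ind_act_linr x)); case: c.
- by move=> a u v hu hv; rewrite ind_act_linr; case: c => _; exact.
move=> _ [k l u m hu hm <-]; rewrite /ind_act tact_pure addbA.
by apply: ind_hcomp_pure => //; apply: uhcompM => //; exact: uhcomp_iota.
Qed.

Lemma ind_act_br i j x y v : x \in hcomp g i -> y \in hcomp g j ->
  ind_act (br x y) v =
  ind_act x (ind_act y v) - ssign K i j *: ind_act y (ind_act x v).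
Proof.
move=> hx hy; rewrite /ind_act (uiota_br hx hy) !tact_mul.
by rewrite (linD (tact_linl v)) (linN (tact_linl v)) (linZ (tact_linl v)).
Qed.

Definition induced : supermodule g :=
  Supermodule ind_act_linr ind_act_linl ind_act_hom ind_act_br.

End Induced.

Section Whittaker.
Variables (K : numFieldType) (g : lieSuperalgebra K) (p : gradedIdeal g).
Variable phi : lieHom p (ground_lie K).

Definition whittaker_annihilator : {pred g} :=
  [pred y | `[< forall x : p, phi (ideal_ad y x) = 0 >]].

Definition bracket_span (S T : {pred g}) : {pred g} :=
  span_of (fun z => exists x y, [/\ x \in S, y \in T & z = br x y]).

Definition char_act (x : p) (m : ground_superspace K) : ground_superspace K :=
  phi x *: m.

Lemma char_act_linr x : linear (char_act x).
Proof. by move=> a u v; rewrite /char_act scalerDr !scalerA mulrC. Qed.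

Lemma char_act_linl m : linear (char_act^~ m).
Proof.
by move=> a x y; rewrite /char_act (lh_lin phi) scalerDl -scalerA.
Qed.

Lemma char_act_hom i j x m : x \in hcomp p i -> m \in hcomp (ground_superspace K) j ->
  char_act x m \in hcomp (ground_superspace K) (i (+) j).
Proof.
move=> /(lh_hom phi); rewrite !inE /char_act.
case: i => /= [/eqP ->|_]; first by rewrite scale0r eqxx orbT.
by case: j => //= /eqP ->; rewrite scaler0.
Qed.

Lemma char_act_br i j x y m : x \in hcomp p i -> y \in hcomp p j ->
  char_act (br x y) m =
  char_act x (char_act y m) - ssign K i j *: char_act y (char_act x m).
Proof.
move=> /(lh_hom phi) + /(lh_hom phi); rewrite !inE /char_act lh_br /= scale0r.
rewrite !scalerA; case: i => /= [/eqP ->|_].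
  by rewrite !(mul0r, mulr0, scale0r) subrr.
by rewrite /ssign mul1r mulrC subrr.
Qed.

(* The one-dimensional p-supermodule C w_phi, with w_phi = 1 even. *)
Definition char_module : supermodule p :=
  Supermodule char_act_linr char_act_linl char_act_hom char_act_br.

Definition whittaker_module : supermodule g := induced (ideal_incl p) char_module.

End Whittaker.

(* Main.v *)
Require Import Defs.
From mathcomp Require Import all_boot all_order all_algebra.
From mathcomp Require Import boolp reals complex.
From mathcomp Require Import fingroup perm zify ring.
From mathcomp Require Import classical_sets functions.
Import Order.TTheory GRing.Theory Num.Theory.
Local Open Scope ring_scope.

Set Implicit Arguments.
Unset Strict Implicit.
Unset Printing Implicit Defensive.

(** Write L for the Whittaker annihilator of phi and w for the generator of W(phi).

    Sufficiency. Filter W(phi) by the number of letters applied to an L-stable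
    subspace V0 containing w on which p acts through phi (C w in case (1),
    C w + C e w in case (2)). The operators x - phi(x), x in p, lower the degree,
    and for dual elements e_i of g, p_i of p with respect to phi([x, p_i]) the
    Euler operator sum_i -(-1)^|e_i| e_i (p_i - phi(p_i)) acts as multiplication
    by the degree modulo lower terms. Hence every nonzero submodule meets V0, and
    a graded one then contains w.

    Necessity. Let y in L be homogeneous, not in p, with [y, y] in the kernel of
    phi. Then p + C y acts on C^2 with p acting by phi and y by a nilpotent matrix
    n of square zero. A relative Poincare-Birkhoff-Witt theorem extends this to a
    linear map f : U(g) -> M_2(C) with f(1) = 1 and f(u x) = f(u) x for x in
    p + C y, so that f(y) = n and f(U(g) y) does not contain 1: the submodule
    generated by y w is proper and nonzero. Over C, the quadratic form
    phi([y, y]) on L_1 / p_1 has an isotropic vector as soon as the dimension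
    exceeds 1.

    The map f is built as a family of multilinear functions on words in g, one
    length at a time. The extensions to words of length n are the common fixed
    points of affine operators, one for each transposition of adjacent letters and
    one for the last letter, which satisfy the braid relations by the Jacobi
    identity; averaging produces such a fixed point in characteristic 0. *)

(** * Fixed points of affine symmetric group actions *)

Section CommonFixedPoint.
Variables (K : numFieldType) (A : lmodType K) (P : A -> Prop) (n : nat).
Variables (s : nat -> A -> A) (t : A -> A).

(** The operators to be averaged carry constant lower-order terms, so they are affine and not
    linear; they still commute with means. *)
Definition affine (f : A -> A) := linear (fun u => f u - f 0).

Lemma affine_mean f m (u : 'I_m.+1 -> A) : affine f ->
  f (m.+1%:R^-1 *: \sum_j u j) = m.+1%:R^-1 *: \sum_j f (u j).
Proof.
move=> fA; have nz : m.+1%:R != 0 :> K by rewrite pnatr_eq0.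
apply/eqP; rewrite -subr_eq0 -[X in f X]addr0.
have E : f (m.+1%:R^-1 *: \sum_j u j + 0) - f 0 =
    m.+1%:R^-1 *: \sum_j (f (u j) - f 0).
  rewrite fA subrr addr0; congr (_ *: _).
  by apply: (big_morph _ (linD fA)); rewrite subrr.
rewrite -[f _](subrK (f 0)) E sumrB scalerBr sumr_const card_ord.
by rewrite -[f 0 *+ _]scaler_nat scalerA mulVf // scale1r subrK subrr.
Qed.

Hypothesis P0 : P 0.
Hypothesis PL : forall a u v, P u -> P v -> P (a *: u + v).
Hypothesis Ps : forall i u, (i < n)%N -> P u -> P (s i u).
Hypothesis Pt : forall u, P u -> P (t u).
Hypothesis sA : forall i, (i < n)%N -> affine (s i).
Hypothesis tA : affine t.
Hypothesis ss : forall i u, (i < n)%N -> P u -> s i (s i u) = u.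
Hypothesis s_braid : forall i u, (i.+1 < n)%N -> P u ->
  s i (s i.+1 (s i u)) = s i.+1 (s i (s i.+1 u)).
Hypothesis s_far : forall i j u, (i.+1 < j)%N -> (j < n)%N -> P u ->
  s i (s j u) = s j (s i u).
Hypothesis tt_idem : forall u, P u -> t (t u) = t u.
(** These two relations place t at the end of the chain as in type B: it commutes with every s_i
    except the last, and it commutes with its own conjugate by the last one. *)
Hypothesis ts : forall i u, (i.+1 < n)%N -> P u -> t (s i u) = s i (t u).
Hypothesis tsts : forall i u, i.+1 = n -> P u ->
  t (s i (t (s i u))) = s i (t (s i (t u))).

(** The cycle s_(i+j-1) ... s_i; [down i j] is the inverse cycle s_i ... s_(i+j-1). *)
Fixpoint up i j u := if j is j'.+1 then s (i + j') (up i j' u) else u.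
Fixpoint down i j u := if j is j'.+1 then down i j' (s (i + j') u) else u.

Lemma P_up i j u : (i + j <= n)%N -> P u -> P (up i j u).
Proof. by elim: j => //= j IH le Pu; apply: Ps; [lia | apply: IH => //; lia]. Qed.
Lemma P_down i j u : (i + j <= n)%N -> P u -> P (down i j u).
Proof. by elim: j u => //= j IH u le Pu; apply: IH; [lia | apply: Ps => //; lia]. Qed.

Lemma downK i j u : (i + j <= n)%N -> P u -> up i j (down i j u) = u.
Proof.
elim: j u => //= j IH u le Pu; rewrite IH ?ss //; try lia.
by apply: Ps => //; lia.
Qed.
Lemma upK i j u : (i + j <= n)%N -> P u -> down i j (up i j u) = u.
Proof.
elim: j u => //= j IH u le Pu; rewrite ss ?IH //; try lia.
by apply: P_up => //; lia.
Qed.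

Lemma up_far i j l u : (i + j < l)%N -> (l < n)%N -> P u ->
  s l (up i j u) = up i j (s l u).
Proof.
elim: j => //= j IH le ln Pu; rewrite -s_far ?IH //; try lia.
by apply: P_up => //; lia.
Qed.

(** Conjugation by a cycle shifts adjacent transpositions by one. The braid relation moves s_l past
    the factors s_(l+1) and s_l; all other factors commute with it. *)
Lemma up_shift i j l u : (i <= l)%N -> (l.+1 < i + j)%N -> (i + j <= n)%N ->
  P u -> s l (up i j u) = up i j (s l.+1 u).
Proof.
elim: j => [|j IH] /= il lij ijn Pu; first lia.
case: (ltngtP l.+1 (i + j)) => c; last 1 first.
- have [j' e] : exists j', j = j'.+1 by exists j.-1; lia.
  have l_eq : l = (i + j')%N by lia.
  subst j; rewrite -c /= -l_eq s_braid ?(@up_far i j' l.+1) //; try lia.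
  by apply: P_up => //; lia.
- rewrite s_far ?IH //; try lia.
  by apply: P_up => //; lia.
- lia.
Qed.

Lemma down_shift i j l u : (i <= l)%N -> (l.+1 < i + j)%N -> (i + j <= n)%N ->
  P u -> s l.+1 (down i j u) = down i j (s l u).
Proof.
move=> il lij ijn Pu; rewrite -[in RHS](downK ijn Pu) up_shift ?upK //; try exact: P_down.
by apply: Ps; [lia | exact: P_down].
Qed.

Lemma t_up i j u : (i + j < n)%N -> P u -> t (up i j u) = up i j (t u).
Proof.
elim: j => //= j IH le Pu; rewrite ts ?IH //; try lia.
by apply: P_up => //; lia.
Qed.
Lemma t_down i j u : (i + j < n)%N -> P u -> t (down i j u) = down i j (t u).
Proof.
elim: j u => //= j IH u le Pu; rewrite IH ?ts //; try lia.
by apply: Ps => //; lia.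
Qed.

(* The partial symmetrizers are built one position at a time: the symmetrizer
   of the positions i0 + 1, ..., n is followed by the mean over the coset
   representatives s_(i0+j-1) ... s_i0. *)
Lemma common_fixed_point :
  exists u, [/\ P u, t u = u & forall i, (i < n)%N -> s i u = u].
Proof.
suff H k : (k <= n)%N -> exists u, [/\ P u, t u = u &
    forall i, (n - k <= i)%N -> (i < n)%N -> s i u = u].
  have [u [Pu tu su]] := H n (leqnn n).
  by exists u; split=> // i; apply: su; lia.
elim: k => [|k IH] kn.
  (* Since t is affine, t 0 need not vanish; idempotency makes it a fixed point. *)
  exists (t 0); split; [exact: Pt | exact: tt_idem | move=> i; lia].
have [f [Pf tf sf]] := IH (ltnW kn).
set i0 := (n - k.+1)%N; have i0m : (i0 + k.+1 = n)%N by lia.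
have i0n : (i0 + k.+1 <= n)%N by lia.
have i0k : (i0 + k < n)%N by lia.
have Pu := P_up i0n Pf; have Ptu := Pt Pu.
(* Conjugating t by the whole cycle gives the analogue of t at the new position i0. Applying it to f
   keeps the invariance under t and under s_l for l > i0, and makes the last translate, j = k + 1,
   invariant under t. *)
pose f' := down i0 k.+1 (t (up i0 k.+1 f)).
have Pf' : P f' by exact: P_down.
have sf' l : (i0 < l)%N -> (l < n)%N -> s l f' = f'.
  case: l => // l il ln; rewrite /f' down_shift //; try lia.
  by rewrite -ts // ?up_shift ?sf //; lia.
have tf' : t f' = f'.
  have Pk := P_up (ltnW i0k) Pf.
  rewrite /f' /= t_down //; last by apply/Ps/Pt/Ps.
  by rewrite tsts // ?t_up ?tf //; lia.
have tuf' : t (up i0 k.+1 f') = up i0 k.+1 f' by rewrite downK // tt_idem.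
have kn' : (forall j : 'I_k.+2, i0 + j <= n)%N by move=> j; have := ltn_ord j; lia.
exists (k.+2%:R^-1 *: \sum_(j < k.+2) up i0 j f'); split.
- rewrite -[_ *: _]addr0; apply: PL => //.
  apply: (big_ind P) => // [u v Pu' Pv|j _]; last exact: P_up.
  by rewrite -[u]scale1r; exact: PL.
- rewrite affine_mean //; congr (_ *: _); apply: eq_bigr => j _.
  case: (ltngtP j k.+1) (ltn_ord j) => [jk _|jk|-> _]; first by rewrite t_up ?tf' //; lia.
  + by lia.
  + exact: tuf'.
move=> l il ln; rewrite affine_mean; last exact: sA.
congr (_ *: _).
(* The operator s_l exchanges the translates j = l - i0 and j = l - i0 + 1 and fixes each of the
   others, so the sum is reindexed by that transposition. *)
have qk : (l - i0 < k.+1)%N by lia.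
pose q := Ordinal (ltnW qk : l - i0 < k.+2)%N.
pose q' := Ordinal (qk : (l - i0).+1 < k.+2)%N.
rewrite [RHS](reindex_inj (@perm_inj _ (tperm q q'))) /=.
apply: eq_bigr => j _; case: tpermP => [->|->|nq nq'].
- by rewrite /= subnKC.
- by rewrite /= subnKC // ss //; apply: P_up => //; lia.
have jq : (j != q)%N by apply/eqP.
have jq' : (j != q')%N by apply/eqP.
move: jq jq'; rewrite -!val_eqE /= => jq jq'.
have jk := ltn_ord j.
case: (ltnP j (l - i0)) => c.
  by rewrite up_far ?sf' //; lia.
by rewrite up_shift ?sf' //; lia.
Qed.

End CommonFixedPoint.

(** * Functions on words *)

Section Projections.
Variables (K : numFieldType) (V : superspace K).

(** The projection is written with the parity automorphism [spar], which makes it a total linear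
    function, while a superspace only asserts that components exist. *)
Definition proj (i : bool) (x : V) : V := 2%:R^-1 *: (x + (-1) ^+ i *: spar x).

Lemma proj_lin i : linear (proj i).
Proof.
move=> a x y; rewrite /proj spar_lin [_ *: (a *: spar x + _)]scalerDr addrACA.
rewrite [LHS]scalerDr [_ *: (a *: spar x)]scalerA [_ ^+ _ * a]mulrC -scalerA.
by rewrite -[a *: x + _]scalerDr !scalerA [a * _]mulrC.
Qed.

Lemma proj_id i x : x \in hcomp V i -> proj i x = x.
Proof.
move=> /spar_hom e; rewrite /proj e scalerA -signr_addb addbb scale1r.
by rewrite -mulr2n -scaler_nat scalerA mulVf ?scale1r // pnatr_eq0.
Qed.

Lemma proj_other i x : x \in hcomp V (~~ i) -> proj i x = 0.
Proof.
move=> /spar_hom e; rewrite /proj e scalerA -signr_addb addbN addbb.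
by rewrite scaleN1r subrr scaler0.
Qed.

Lemma projE x : x = proj false x + proj true x.
Proof.
rewrite /proj -scalerDr !scale1r scaleN1r addrACA subrr addr0.
by rewrite -mulr2n -scaler_nat scalerA mulVf ?scale1r // pnatr_eq0.
Qed.

Lemma proj_hom i x : proj i x \in hcomp V i.
Proof.
have [x0 [x1 [h0 h1 ->]]] := hcomp_sum x.
rewrite (linD (@proj_lin i)); case: i.
  by rewrite [proj _ x0]proj_other // add0r proj_id.
by rewrite [proj _ x1]proj_other // addr0 proj_id.
Qed.

Lemma graded_proj (N : {pred V}) i x : graded_pred N -> submod_closed N ->
  x \in N -> proj i x \in N.
Proof.
move=> gN [N0 _] /gN [x0 [x1 [n0 h0 n1 h1 ->]]]; rewrite (linD (@proj_lin i)).
case: i; first by rewrite [proj _ x0]proj_other // add0r proj_id.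
by rewrite [proj _ x1]proj_other // addr0 proj_id.
Qed.

End Projections.

(** * Words in homogeneous letters, with the super skew-symmetry and Jacobi identities for
    multilinear functions *)

Section Words.
Variables (K : numFieldType) (g : lieSuperalgebra K) (D : lmodType K).

(* The letter (i, x) stands for the component of parity i of x, so that every
   pair is a legitimate homogeneous letter. *)
Definition letter : Type := (bool * g)%type.
Definition lval (X : letter) : g := proj X.1 X.2.
Definition lbr (X Y : letter) : letter := (X.1 (+) Y.1, br (lval X) (lval Y)).
Definition lsign (X Y : letter) : K := ssign K X.1 Y.1.

Lemma lval_hom X : lval X \in hcomp g X.1.
Proof. exact: proj_hom. Qed.

Lemma lval_lbr X Y : lval (lbr X Y) = br (lval X) (lval Y).
Proof. by apply: proj_id; apply: br_hom; exact: proj_hom. Qed.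

Definition multilinear (F : seq letter -> D) := forall a b i,
  linear (fun x => F (a ++ (i, x) :: b)).

Lemma lsignC X Y : lsign X Y = lsign Y X.
Proof. by rewrite /lsign /ssign andbC. Qed.

Lemma lsign2 X Y : lsign X Y * lsign X Y = 1.
Proof. by rewrite /lsign /ssign -signr_addb addbb. Qed.

Lemma lsign_lbrl X Y Z : lsign (lbr X Y) Z = lsign X Z * lsign Y Z.
Proof. by rewrite /lsign /ssign /= andb_addl signr_addb. Qed.

Lemma lsign_lbrr X Y Z : lsign Z (lbr X Y) = lsign Z X * lsign Z Y.
Proof. by rewrite lsignC lsign_lbrl !(lsignC Z). Qed.

Variable F : seq letter -> D.
Hypothesis FL : multilinear F.

Lemma multilinear_lbrC a b X Y :
  F (a ++ lbr X Y :: b) = - (lsign X Y *: F (a ++ lbr Y X :: b)).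
Proof.
have L := @FL a b (X.1 (+) Y.1).
rewrite /lbr (br_skew (lval_hom X) (lval_hom Y)) (linN L) (linZ L).
by rewrite [in Y.1 (+) X.1]addbC.
Qed.

Lemma multilinear_jacobi a b X Y Z :
  F (a ++ lbr X (lbr Y Z) :: b) = F (a ++ lbr (lbr X Y) Z :: b) +
    lsign X Y *: F (a ++ lbr Y (lbr X Z) :: b).
Proof.
have L := @FL a b (X.1 (+) (Y.1 (+) Z.1)).
have E Z1 Z2 : lbr Z1 Z2 = (Z1.1 (+) Z2.1, br (lval Z1) (lval Z2)) by [].
rewrite (E X) (E (lbr X Y)) (E Y (lbr X Z)) !lval_lbr.
rewrite (br_jacobi _ (lval_hom X) (lval_hom Y)) (linD L) (linZ L) /=.
by rewrite addbA [Y.1 (+) (X.1 (+) _)]addbCA !addbA.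
Qed.

End Words.

Lemma split2 (T : Type) (w : seq T) i : (i.+1 < size w)%N ->
  exists a X Y b, size a = i /\ w = a ++ X :: Y :: b.
Proof.
move=> lt; exists (take i w); have := cat_take_drop i w.
case E : (drop i w) => [|X [|Y b]] e.
- by move: (size_drop i w); rewrite E /=; lia.
- by move: (size_drop i w); rewrite E /=; lia.
exists X, Y, b; split=> //; rewrite size_take; case: ltnP => //; lia.
Qed.

(** * Extension of a representation of a subalgebra h to functions on words in g *)

Section Extension.
Variables (K : numFieldType) (g : lieSuperalgebra K) (D : algType K).
Variables (h : {pred g}) (pi : g -> g) (alpha : g -> D).
Hypothesis h_br : forall x y, x \in h -> y \in h -> br x y \in h.
Hypothesis pi_lin : linear pi.
Hypothesis pi_hom : forall i x, x \in hcomp g i -> pi x \in hcomp g i.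
Hypothesis pi_in : forall x, pi x \in h.
Hypothesis pi_id : forall x, x \in h -> pi x = x.
Hypothesis alpha_lin : linear alpha.
Hypothesis alpha_br : forall i j x y, x \in h -> y \in h ->
  x \in hcomp g i -> y \in hcomp g j ->
  alpha (br x y) = alpha x * alpha y - ssign K i j *: (alpha y * alpha x).

Local Notation letter := (letter g).
Implicit Types (a b w : seq letter) (X Y Z : letter).

Lemma pi_proj i x : pi (proj i x) = proj i (pi x).
Proof.
have hp j : pi (proj j x) \in hcomp g j by apply: pi_hom; exact: proj_hom.
rewrite [in RHS](projE x) (linD pi_lin) (linD (@proj_lin _ _ i)).
case: i.
  by rewrite [X in _ = X + _](@proj_other _ _ true _ (hp false)) add0r (proj_id (hp true)).
by rewrite [X in _ = _ + X](@proj_other _ _ false _ (hp true)) addr0 (proj_id (hp false)).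
Qed.

Definition lalpha X := alpha (lval X).
Definition linner X : letter := (X.1, pi X.2).
Definition louter X : letter := (X.1, X.2 - pi X.2).

Lemma lval_linner X : lval (linner X) = pi (lval X).
Proof. by rewrite /lval pi_proj. Qed.

Lemma lalpha_lbr X Y : lalpha (lbr (linner X) (linner Y)) =
  lalpha (linner X) * lalpha (linner Y) - lsign X Y *: (lalpha (linner Y) * lalpha (linner X)).
Proof.
rewrite /lalpha lval_lbr; apply: alpha_br; rewrite ?lval_linner //;
  by apply: pi_hom; exact: lval_hom.
Qed.

Lemma linner_louter X : linner (louter X) = (X.1, 0).
Proof. by rewrite /linner /= (linD pi_lin) (linN pi_lin) [pi (pi _)]pi_id ?subrr. Qed.

Lemma lalpha0 i : lalpha (i, 0) = 0.
Proof. by rewrite /lalpha /lval /= (lin0 (@proj_lin _ _ i)) (lin0 alpha_lin). Qed.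

Lemma louter_louter X : louter (louter X) = louter X.
Proof.
have := linner_louter X; rewrite {1}/linner => -[e].
by rewrite {1}/louter e subr0; case: (louter X).
Qed.

(** On words of length at most n, F behaves like a functional on the part of U(g) of degree at most
    n with F(1) = 1 and F(u x) = F(u) alpha(x) for x in h. In [cmp_alpha] the bound is strict
    because the letter x counts towards the length. *)
Record compatible (F : seq letter -> D) (n : nat) : Prop := Compatible {
  cmp_lin : multilinear F;
  cmp_comm : forall a X Y b, (size (a ++ X :: Y :: b) <= n)%N ->
    F (a ++ X :: Y :: b) =
    lsign X Y *: F (a ++ Y :: X :: b) + F (a ++ lbr X Y :: b);
  cmp_alpha : forall a i x, (size a < n)%N -> x \in h ->
    F (a ++ [:: (i, x)]) = F a * lalpha (i, x);
  cmp_nil : F [::] = 1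
}.

(** * From words of length n to words of length n + 1 *)

Section Step.
Variables (F : seq letter -> D) (n : nat).
Hypothesis FC : compatible F n.

Let FL := cmp_lin FC.

(** The value that the commutation relation at position i prescribes on w, given f on the swapped
    word; the bracket term is one letter shorter and is supplied by F. Fixed points are the
    functions satisfying that relation. *)
Definition swap_op i (f : seq letter -> D) w : D :=
  if size w == n.+1 then
    if drop i w is X :: Y :: b then
      lsign X Y *: f (take i w ++ Y :: X :: b) + F (take i w ++ lbr X Y :: b)
    else 0
  else 0.

(** The value prescribed on w once the h-component of the last letter acts through alpha. The
    default of [last] is never reached, since w has n + 1 letters. *)
Definition tail_op (f : seq letter -> D) w : D :=
  if size w == n.+1 then
    let X := last (false, 0) w in
    f (take n w ++ [:: louter X]) + F (take n w) * lalpha (linner X)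
  else 0.

Lemma swap_opE i f a X Y b : size a = i -> size (a ++ X :: Y :: b) = n.+1 ->
  swap_op i f (a ++ X :: Y :: b) =
  lsign X Y *: f (a ++ Y :: X :: b) + F (a ++ lbr X Y :: b).
Proof.
by move=> <- e; rewrite /swap_op e eqxx drop_size_cat // take_size_cat.
Qed.

Lemma tail_opE f a X : size a = n ->
  tail_op f (a ++ [:: X]) = f (a ++ [:: louter X]) + F a * lalpha (linner X).
Proof.
by move=> e; rewrite /tail_op last_cat /= take_size_cat // size_cat addn1 e eqxx.
Qed.

Definition supported (f : seq letter -> D) :=
  multilinear f /\ forall w, size w <> n.+1 -> f w = 0.

Lemma swap_op0 i f w : size w <> n.+1 -> swap_op i f w = 0.
Proof. by move=> /eqP; rewrite /swap_op => /negbTE ->. Qed.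
Lemma tail_op0 f w : size w <> n.+1 -> tail_op f w = 0.
Proof. by move=> /eqP; rewrite /tail_op => /negbTE ->. Qed.

Lemma swap_op_affine i : affine (swap_op i).
Proof.
move=> c u v; apply/funext => w.
rewrite !fctE /= /swap_op.
case: (size w == n.+1); last by rewrite !subr0 scaler0 addr0.
case: (drop i w) => [|X [|Y b]]; rewrite ?(subr0, scaler0, addr0) //.
by rewrite !add0r !addrK scalerDr !scalerA [c * _]mulrC.
Qed.

Lemma tail_op_affine : affine tail_op.
Proof.
move=> c u v; apply/funext => w; rewrite !fctE /= /tail_op.
case: (size w == n.+1); last by rewrite !subr0 scaler0 addr0.
by rewrite !add0r !addrK.
Qed.

Lemma swap_op_supported i f : (i < n)%N -> supported f ->
  supported (swap_op i f).
Proof.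
move=> lt_in [fL f0]; split; last by move=> w /swap_op0.
move=> a b j k x y; have sz z : size (a ++ (j, z) :: b) = (size a + size b)%N.+1.
  by rewrite size_cat /= addnS.
case: (eqVneq (size a + size b)%N n) => [en|ne]; last first.
  by rewrite !swap_op0 ?scaler0 ?addr0 // sz => -[] /eqP; exact/negP.
(* The varied letter, at position [size a], lies before the swapped pair, after it, or is its second
   or first member. *)
case: (ltngtP (size a) i) => [lt|gt|e].
- have : ((i - (size a).+1).+1 < size b)%N by lia.
  move=> /split2 [b1 [X [Y [b2 [sb eb]]]]].
  have E z : a ++ (j, z) :: b = (a ++ (j, z) :: b1) ++ X :: Y :: b2.
    by rewrite eb -catA.
  have sb1 z : size (a ++ (j, z) :: b1) = i.
    by rewrite size_cat /= sb addnS -addSn subnKC.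
  rewrite !E !swap_opE; try by rewrite -?E ?sz ?en.
  rewrite -!catA /= fL FL !scalerDr addrACA !scalerA.
  by rewrite [k * _]mulrC.
- have [e|ne] := eqVneq (size a) i.+1.
    have [a' [X ea]] : exists a' X, a = rcons a' X.
      by case/lastP: (a) e => // a' X _; exists a', X.
    have E z : a ++ (j, z) :: b = a' ++ X :: (j, z) :: b by rewrite ea cat_rcons.
    have sa : size a' = i by move: e; rewrite ea size_rcons => -[].
    rewrite !E !swap_opE; try by rewrite -?E ?sz ?en.
    rewrite /lbr /lval /= proj_lin br_linr.
    rewrite (fL a' (X :: b)) (FL a' b) !scalerDr addrACA !scalerA.
    by rewrite [k * _]mulrC.
  have : (i.+1 < size a)%N by lia.
  move=> /split2 [a1 [X [Y [a2 [sa ea]]]]].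
  have E z : a ++ (j, z) :: b = a1 ++ X :: Y :: (a2 ++ (j, z) :: b).
    by rewrite ea -catA.
  rewrite !E !swap_opE; try by rewrite -?E ?sz ?en.
  have E1 z : a1 ++ Y :: X :: (a2 ++ (j, z) :: b) =
    (a1 ++ Y :: X :: a2) ++ (j, z) :: b by rewrite -catA.
  have E2 z : a1 ++ lbr X Y :: (a2 ++ (j, z) :: b) =
    (a1 ++ lbr X Y :: a2) ++ (j, z) :: b by rewrite -catA.
  rewrite !E1 !E2 fL FL !scalerDr addrACA !scalerA.
  by rewrite [k * _]mulrC.
case: b sz en => [|Y b] sz en; first by move: lt_in; rewrite -e -en addn0 ltnn.
rewrite !swap_opE ?sz ?en //.
have E z : a ++ Y :: (j, z) :: b = (rcons a Y) ++ (j, z) :: b.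
  by rewrite cat_rcons.
rewrite /lbr /lval /= !E proj_lin br_linl fL (FL a b).
rewrite !scalerDr addrACA !scalerA.
by rewrite [k * _]mulrC.
Qed.

Lemma tail_op_supported f : supported f -> supported (tail_op f).
Proof.
move=> [fL f0]; split; last by move=> w /tail_op0.
move=> a b j k x y; have sz z : size (a ++ (j, z) :: b) = (size a + size b)%N.+1.
  by rewrite size_cat /= addnS.
case: (eqVneq (size a + size b)%N n) => [en|ne]; last first.
  by rewrite !tail_op0 ?scaler0 ?addr0 // sz => -[] /eqP; exact/negP.
case/lastP: b sz en => [|b X] sz en.
  have sa : size a = n by rewrite -en addn0.
  rewrite !tail_opE // /louter /linner /=.
  have -> : k *: x + y - pi (k *: x + y) = k *: (x - pi x) + (y - pi y).
    by rewrite pi_lin scalerBr opprD addrACA.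
  rewrite fL /lalpha /lval /= pi_lin proj_lin alpha_lin.
  by rewrite mulrDr -scalerAr scalerDr addrACA.
have E z : a ++ (j, z) :: rcons b X = (a ++ (j, z) :: b) ++ [:: X].
  by rewrite -catA /= cats1.
have sa z : size (a ++ (j, z) :: b) = n.
  by move: en; rewrite size_rcons size_cat /= => <-; lia.
rewrite !E !tail_opE // -!catA /= fL FL mulrDl -scalerAl scalerDr.
by rewrite addrACA.
Qed.

Lemma word_eq (u v : seq letter -> D) :
  (forall w, size w <> n.+1 -> u w = 0) -> (forall w, size w <> n.+1 -> v w = 0) ->
  (forall w, size w = n.+1 -> u w = v w) -> u = v.
Proof.
move=> u0 v0 uv; apply/funext => w; have [/uv //|/eqP ne] := eqVneq (size w) n.+1.
by rewrite u0 ?v0.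
Qed.

(** The two signs multiply to 1 and super skew-symmetry cancels the two bracket terms. *)
Lemma swap_opK i u : (i < n)%N -> supported u -> swap_op i (swap_op i u) = u.
Proof.
move=> lt [uL u0]; apply: word_eq => // [w|w sw]; first exact: swap_op0.
have [|a [X [Y [b [sa ew]]]]] := @split2 _ w i; first lia.
have sw' : size (a ++ Y :: X :: b) = n.+1 by rewrite -sw ew !size_cat.
rewrite ew in sw *; rewrite !swap_opE // scalerDr scalerA [lsign Y X]lsignC lsign2.
by rewrite scale1r -addrA (multilinear_lbrC FL a b X Y) subrr addr0.
Qed.

(** Both sides evaluate u on the reversed triple. The remaining terms are values of F on words of
    length n, where the commutation relation already holds; it reduces their difference to the
    Jacobi identity. *)
Lemma swap_op_braid i u : (i.+1 < n)%N -> supported u ->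
  swap_op i (swap_op i.+1 (swap_op i u)) =
  swap_op i.+1 (swap_op i (swap_op i.+1 u)).
Proof.
move=> lt [uL u0]; apply: word_eq => [w|w|w sw]; try exact: swap_op0.
have [|a [X [Y [b [sa ew]]]]] := @split2 _ w i; first lia.
case: b ew => [|Z b] ew; first by move: sw; rewrite ew size_cat /=; lia.
have sz X' Y' Z' : size (a ++ X' :: Y' :: Z' :: b) = n.+1.
  by rewrite -sw ew !size_cat.
have sz' X' : size (rcons a X') = i.+1 by rewrite size_rcons sa.
have R X' Y' Z' u' : swap_op i.+1 u' (a ++ X' :: Y' :: Z' :: b) =
    lsign Y' Z' *: u' (a ++ X' :: Z' :: Y' :: b) + F (a ++ X' :: lbr Y' Z' :: b).
  rewrite -cat_rcons swap_opE ?cat_rcons //.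
have C X' Y' : F (a ++ X' :: Y' :: b) =
    lsign X' Y' *: F (a ++ Y' :: X' :: b) + F (a ++ lbr X' Y' :: b).
  apply: (cmp_comm FC); move: (sz X X X); rewrite !size_cat /=; lia.
have L X' Y' Z' u' : swap_op i u' (a ++ X' :: Y' :: Z' :: b) =
    lsign X' Y' *: u' (a ++ Y' :: X' :: Z' :: b) + F (a ++ lbr X' Y' :: Z' :: b).
  exact: swap_opE.
rewrite ew !(L, R).
rewrite !scalerDr !scalerA (C (lbr X Y) Z) (C Y (lbr X Z)) (C X (lbr Y Z)).
rewrite (multilinear_jacobi FL a b X Y Z) !lsign_lbrl !lsign_lbrr !scalerDr !scalerA.
rewrite !mulrA [lsign Y X]lsignC lsign2 mul1r.
rewrite [lsign Y Z * lsign X Z]mulrC [lsign X Z * _ * _]mulrC !mulrA.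
rewrite -!addrA; congr (_ + _).
move: (lsign X Y *: F (a ++ lbr Y (lbr X Z) :: b)) (F (a ++ lbr (lbr X Y) Z :: b)).
move: (lsign X Z * lsign Y Z *: _) (lsign X Y * _ *: F _) (lsign Y Z *: _).
by move=> A1 A2 A3 A4 A5; rewrite !addrA [LHS](ACl (4*2*1*5*3)).
Qed.

(** The swaps touch disjoint letters; the correction terms agree because F already satisfies the
    commutation relation at either place. *)
Lemma swap_op_far i j u : (i.+1 < j)%N -> (j < n)%N -> supported u ->
  swap_op i (swap_op j u) = swap_op j (swap_op i u).
Proof.
move=> ij lt [uL u0]; apply: word_eq => [w|w|w sw]; try exact: swap_op0.
have [|a [X [Y [b' [sa ew']]]]] := @split2 _ w i; first lia.
have [|b [Z [T [c [sb ew]]]]] := @split2 _ b' (j - i.+2).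
  by move: sw; rewrite ew' size_cat /=; lia.
rewrite {b'}ew in ew'.
have sz X' Y' Z' T' : size (a ++ X' :: Y' :: b ++ Z' :: T' :: c) = n.+1.
  by rewrite -sw ew' !(size_cat, size_rcons) /= !size_cat.
have E X' Y' (c' : seq letter) : a ++ X' :: Y' :: b ++ c' =
    (a ++ X' :: Y' :: b) ++ c' by rewrite -catA.
have E1 X' (c' : seq letter) : a ++ X' :: b ++ c' = (a ++ X' :: b) ++ c'.
  by rewrite -catA.
have sab X' Y' : size (a ++ X' :: Y' :: b) = j by rewrite size_cat /= sb; lia.
have L X' Y' Z' T' u' : swap_op i u' (a ++ X' :: Y' :: b ++ Z' :: T' :: c) =
    lsign X' Y' *: u' (a ++ Y' :: X' :: b ++ Z' :: T' :: c) +
    F (a ++ lbr X' Y' :: b ++ Z' :: T' :: c).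
  exact: swap_opE.
have R X' Y' Z' T' u' : swap_op j u' (a ++ X' :: Y' :: b ++ Z' :: T' :: c) =
    lsign Z' T' *: u' (a ++ X' :: Y' :: b ++ T' :: Z' :: c) +
    F (a ++ X' :: Y' :: b ++ lbr Z' T' :: c).
  by rewrite !E swap_opE // -E.
have CL : F (a ++ X :: Y :: b ++ lbr Z T :: c) =
    lsign X Y *: F (a ++ Y :: X :: b ++ lbr Z T :: c) +
    F (a ++ lbr X Y :: b ++ lbr Z T :: c).
  by apply: (cmp_comm FC); move: (sz X Y Z T); rewrite !(size_cat, size_rcons) /= !size_cat /=; lia.
have CR : F (a ++ lbr X Y :: b ++ Z :: T :: c) =
    lsign Z T *: F (a ++ lbr X Y :: b ++ T :: Z :: c) +
    F (a ++ lbr X Y :: b ++ lbr Z T :: c).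
  rewrite !E1; apply: (cmp_comm FC); move: (sz X Y Z T).
  by rewrite !(size_cat, size_rcons) /= !size_cat /=; lia.
rewrite ew' !(L, R) CL CR !scalerDr !scalerA [lsign Z T * _]mulrC.
by rewrite !addrA [LHS](ACl (1*3*2*4)).
Qed.

Lemma tail_op_idem u : supported u -> tail_op (tail_op u) = tail_op u.
Proof.
move=> [uL u0]; apply: word_eq => [w|w|w]; try exact: tail_op0.
case/lastP: w => // w X; rewrite size_rcons -cats1 => -[sw].
by rewrite !tail_opE // louter_louter linner_louter lalpha0 mulr0 addr0.
Qed.

Lemma F_split a b X : F (a ++ X :: b) = F (a ++ louter X :: b) + F (a ++ linner X :: b).
Proof.
rewrite -(linD (@FL a b X.1)) subrK.
by case: X.
Qed.

Lemma F_tail a X : (size a < n)%N -> F (a ++ [:: linner X]) = F a * lalpha (linner X).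
Proof. by move=> lt; apply: (cmp_alpha FC). Qed.

(** Here the correction terms agree by the commutation relation of F on the first n letters and by
    its compatibility with alpha on the last letter. *)
Lemma tail_swap i u : (i.+1 < n)%N -> supported u ->
  tail_op (swap_op i u) = swap_op i (tail_op u).
Proof.
move=> lt [uL u0]; apply: word_eq => [w|w|w]; try by [exact: tail_op0 | exact: swap_op0].
case/lastP: w => // w Z; rewrite size_rcons -cats1 => -[sw].
have [|a [X [Y [b [sa ew]]]]] := @split2 _ w i; first lia.
have sz X' Y' : size (a ++ X' :: Y' :: b) = n by rewrite -sw ew !size_cat.
have E X' Y' (c' : seq letter) : (a ++ X' :: Y' :: b) ++ c' =
    a ++ X' :: Y' :: b ++ c' by rewrite -catA.
have L X' Y' Z' u' : swap_op i u' (a ++ X' :: Y' :: b ++ [:: Z']) =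
    lsign X' Y' *: u' (a ++ Y' :: X' :: b ++ [:: Z']) +
    F (a ++ lbr X' Y' :: b ++ [:: Z']).
  by apply: swap_opE; rewrite // -E size_cat sz addn1.
have R X' Y' Z' u' : tail_op u' (a ++ X' :: Y' :: b ++ [:: Z']) =
    u' (a ++ X' :: Y' :: b ++ [:: louter Z']) +
    F (a ++ X' :: Y' :: b) * lalpha (linner Z').
  by rewrite -!E tail_opE.
rewrite ew E !(L, R) (cmp_comm FC); last by rewrite sz.
have E1 X' (c' : seq letter) : a ++ X' :: b ++ c' = (a ++ X' :: b) ++ c'.
  by rewrite -catA.
rewrite [in RHS]E1 (F_split _ [::] Z) F_tail; last first.
  by move: (sz X Y); rewrite !size_cat /=; lia.
rewrite -E1 mulrDl scalerDr -scalerAl !addrA.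
by rewrite [LHS](ACl (1*3*2*4)).
Qed.

(** With the last two letters split into components in h and in the kernel of [pi], everything
    matches except the bracket of the two h-components. That term is handled by h being a subalgebra
    and alpha respecting its bracket. *)
Lemma tail_swap_tail_swap i u : i.+1 = n -> supported u ->
  tail_op (swap_op i (tail_op (swap_op i u))) =
  swap_op i (tail_op (swap_op i (tail_op u))).
Proof.
move=> lt [uL u0]; apply: word_eq => [w|w|w sw]; try by [exact: tail_op0 | exact: swap_op0].
have [|a [X [Y [b [sa ew]]]]] := @split2 _ w i; first lia.
have b0 : b = [::].
  by apply: size0nil; move: sw; rewrite ew size_cat /=; lia.
subst b.
have sz X' Y' : size (a ++ [:: X'; Y']) = n.+1 by rewrite -sw ew !size_cat.
have L X' Y' u' : swap_op i u' (a ++ [:: X'; Y']) =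
    lsign X' Y' *: u' (a ++ [:: Y'; X']) + F (a ++ [:: lbr X' Y']).
  exact: swap_opE.
have R X' Y' u' : tail_op u' (a ++ [:: X'; Y']) =
    u' (a ++ [:: X'; louter Y']) + F (a ++ [:: X']) * lalpha (linner Y').
  have E Y2 : a ++ [:: X'; Y2] = (a ++ [:: X']) ++ [:: Y2] by rewrite -catA.
  by rewrite !E tail_opE // size_cat addn1 sa.
have sgo X' Y' : lsign X' (louter Y') = lsign X' Y' by [].
have sgo' X' Y' : lsign (louter X') Y' = lsign X' Y' by [].
have an : (size a < n)%N by rewrite sa -lt.
rewrite ew !(L, R) !sgo !sgo' !scalerDr !scalerA ![lsign Y X]lsignC !lsign2 !scale1r.
have Dl Y' : F (a ++ [:: lbr X Y']) =
    F (a ++ [:: lbr (louter X) Y']) + F (a ++ [:: lbr (linner X) Y']).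
  rewrite -(linD (@FL a [::] _)) -(linD (@br_linl _ _ (lval Y'))).
  by rewrite -(linD (@proj_lin _ _ _)) /= subrK.
have Dr X' : F (a ++ [:: lbr X' Y]) =
    F (a ++ [:: lbr X' (louter Y)]) + F (a ++ [:: lbr X' (linner Y)]).
  rewrite -(linD (@FL a [::] _)) -(linD (@br_linr _ _ (lval X'))).
  by rewrite -(linD (@proj_lin _ _ _)) /= subrK.
have C Y' : lsign X Y' *: F (a ++ [:: lbr Y' (louter X)]) =
    - F (a ++ [:: lbr (louter X) Y']).
  by rewrite (multilinear_lbrC FL a [::] (louter X)) opprK sgo'.
have H : F (a ++ [:: lbr (linner X) (linner Y)]) = F a * lalpha (linner X) * lalpha (linner Y) -
    lsign X Y *: (F a * lalpha (linner Y) * lalpha (linner X)).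
  rewrite (cmp_alpha FC) //; last by apply: h_br; rewrite lval_linner.
  rewrite -[(_, _)]/(lbr (linner X) (linner Y)) lalpha_lbr mulrBr -scalerAr.
  by rewrite !mulrA.
have C' := C (louter Y); rewrite sgo in C'.
rewrite C' C (F_split a [::] X) (F_split a [::] Y) !F_tail //.
rewrite (Dl (louter Y)) (Dl Y) (Dr (linner X)) H !mulrDl scalerDr !addrA.
rewrite [LHS](ACl (1*3*5*6*7*(4*2))) [RHS](ACl (1*4*7*2*8*(6*3)*(5*9))) /=.
by rewrite !subrr !addr0.
Qed.

(** A common fixed point of the n swaps and of the tail operator satisfies every relation in length
    n + 1; it is glued to F on the other lengths. *)
Lemma compatible_step : exists F', compatible F' n.+1 /\
  forall w, (size w <= n)%N -> F' w = F w.
Proof.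
have [f [[fL f0] tf sf]] : exists u, [/\ supported u, tail_op u = u &
    forall i, (i < n)%N -> swap_op i u = u].
  apply: common_fixed_point.
  - split=> // a b i k x y.
    by rewrite -[LHS]/(0 : D) -[RHS]/(k *: (0 : D) + 0) scaler0 addr0.
  - move=> a u v [uL u0] [vL v0]; split.
      move=> a' b' i k x y; rewrite !fctE uL vL !scalerDr !scalerA addrACA.
      by rewrite [a * k]mulrC.
    by move=> w ne; rewrite !fctE u0 // v0 // scaler0 addr0.
  - exact: swap_op_supported.
  - exact: tail_op_supported.
  - by move=> i _; exact: swap_op_affine.
  - exact: tail_op_affine.
  - exact: swap_opK.
  - exact: swap_op_braid.
  - exact: swap_op_far.
  - exact: tail_op_idem.
  - exact: tail_swap.
  - exact: tail_swap_tail_swap.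
pose F' w := if size w == n.+1 then f w else F w.
have F'E w : (size w <= n)%N -> F' w = F w by rewrite /F'; case: eqP => //; lia.
have F'f w : size w = n.+1 -> F' w = f w by rewrite /F' => ->; rewrite eqxx.
exists F'; split=> //; split.
- move=> a b i k x y; have sz z : size (a ++ (i, z) :: b) = size (a ++ (i, x) :: b).
    by rewrite !size_cat.
  by rewrite /F' !(sz (_ + _)) (sz y); case: ifP => _; [exact: fL | exact: FL].
- move=> a X Y b; have sz : size (a ++ Y :: X :: b) = size (a ++ X :: Y :: b).
    by rewrite !size_cat.
  have sz' : (size (a ++ lbr X Y :: b)).+1 = size (a ++ X :: Y :: b).
    by rewrite !size_cat /= !addnS.
  rewrite leq_eqVlt => /orP[/eqP e|]; last first.
    rewrite ltnS => le; rewrite !F'E ?sz //; last by rewrite -ltnS sz' ltnW.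
    exact: (cmp_comm FC).
  rewrite (F'f _ e) F'f ?sz // (F'E (a ++ lbr X Y :: b)); last by rewrite -ltnS sz' e.
  by rewrite -{1}(sf (size a)) ?swap_opE //; move: e; rewrite size_cat /=; lia.
- move=> a i x; rewrite ltnS leq_eqVlt => /orP[/eqP e|lt] hx; last first.
    rewrite !F'E ?(ltnW lt) //; last by rewrite size_cat addn1.
    exact: (cmp_alpha FC).
  rewrite F'f; last by rewrite size_cat addn1 e.
  rewrite F'E ?e // -tf tail_opE // /louter /linner /= pi_id // subrr.
  by rewrite (lin0 (fL a [::] i)) add0r.
by rewrite F'E // (cmp_nil FC).
Qed.

End Step.

Lemma compatible0 : compatible (fun w => (w == [::])%:R) 0.
Proof.
split=> // [a b i k x y|[]//].
have E z : (a ++ (i, z) :: b == [::]) = false by case: a.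
by rewrite !E scaler0 addr0.
Qed.

(** The extensions are chosen successively. The value on a word is stable from the level equal to
    its length on, which defines the limit. *)
Lemma compatible_exists : exists F, forall n, compatible F n.
Proof.
pose next n (F : {F | compatible F n}) : {F' | compatible F' n.+1 /\
  forall w, (size w <= n)%N -> F' w = sval F w} := cid (compatible_step (svalP F)).
pose fix G n : {F | compatible F n} :=
  if n is n'.+1 then exist _ (sval (next n' (G n'))) (proj1 (svalP (next n' (G n'))))
  else exist _ _ compatible0.
have GS n w : (size w <= n)%N -> sval (G n.+1) w = sval (G n) w.
  exact: (proj2 (svalP (next n (G n)))).
have GE n w : (size w <= n)%N -> sval (G n) w = sval (G (size w)) w.
  elim: n => [|n IH]; first by case: w.
  by rewrite leq_eqVlt => /orP[/eqP -> //|le]; rewrite GS ?IH.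
exists (fun w => sval (G (size w)) w) => n.
split.
- move=> a b i k x y.
  have sz z : size (a ++ (i, z) :: b) = (size a + size b).+1%N.
    by rewrite size_cat /= addnS.
  by rewrite !sz; exact: (cmp_lin (svalP (G _))).
- move=> a X Y b _.
  have C := cmp_comm (svalP (G (size (a ++ X :: Y :: b)))) (leqnn _).
  rewrite C !GE // !size_cat //=; lia.
- move=> a i x _ hx.
  have C := cmp_alpha (svalP (G (size a).+1)) i (leqnn _) hx.
  by rewrite size_cat addn1 C GE.
exact: (cmp_nil (svalP (G 0%N))).
Qed.

End Extension.

(** * A relative Poincare-Birkhoff-Witt theorem *)

(** Zorn's lemma for the subspaces of A that meet H trivially: if some a in A were outside C + H,
    the line through a could be added to a maximal C. *)
Lemma complement_exists (K : numFieldType) (V : lmodType K) (A H : {pred V}) :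
  submod_closed A -> submod_closed H ->
  exists C : V -> Prop, [/\ forall k u v, C u -> C v -> C (k *: u + v),
    forall u, C u -> u \in A, forall u, C u -> u \in H -> u = 0 &
    forall a, a \in A -> exists2 c, C c & a - c \in H].
Proof.
move=> cA cH; have [A0 AL] := cA; have [H0 HL] := cH.
pose P (C : set V) := [/\ forall k u v, C u -> C v -> C (k *: u + v),
  forall u, C u -> u \in A & forall u, C u -> u \in H -> u = 0].
have [] := @Zorn_bigcup V P.
  move=> F FP Ftot; split.
  - move=> k u v [X FX Xu] [Y FY Yv].
    have [XY|YX] := Ftot _ _ FX FY.
      by exists Y => //; have [L _ _] := FP _ FY; apply: L => //; exact: XY.
    by exists X => //; have [L _ _] := FP _ FX; apply: L => //; exact: YX.
  - by move=> u [X /FP[_ XA _]]; exact: XA.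
  - by move=> u [X /FP[_ _ XH]]; exact: XH.
move=> C [[CL CA CH] Cmax].
have maxC B : P B -> (C `<=` B)%classic -> (B `<=` C)%classic.
  by move=> PB CB; apply: contrapT => nBC; apply: (Cmax B) PB; split.
(* The condition [P] admits the empty set, as the union of the empty chain requires, so 0 has to
   come from maximality. *)
have C0 : C 0.
  apply: (maxC (fun u => C u \/ u = 0)); [split| |by right] => //.
  - move=> k u v [Cu|->] [Cv|->]; rewrite ?(scaler0, addr0, add0r); try by left.
    + left; exact: CL.
    + by left; rewrite -[u]scale1r scalerA -[_ *: _]addr0; move: (CL (k - 1) u u Cu Cu);
      rewrite scalerBl scale1r subrK mulr1 addr0.
    + by right.
  - by move=> u [/CA|->].
  - by move=> u [/CH|->].
  - by move=> u; left.
exists C; split=> // a Aa; apply: contrapT => na.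
have Ca : C a.
  apply: (maxC (fun u => exists c t, C c /\ u = c + t *: a)).
  - split.
    + move=> k u v [c [t [Cc ->]]] [c' [t' [Cc' ->]]].
      exists (k *: c + c'), (k * t + t'); split; first exact: CL.
      by rewrite scalerDr scalerA addrACA -scalerDl.
    + by move=> u [c [t [/CA Ac ->]]]; rewrite addrC; exact: AL.
    move=> u [c [t [Cc ->]]] Hu.
    have [t0|nt] := eqVneq t 0.
      by move: Hu; rewrite t0 scale0r addr0; exact: CH.
    case: na; exists (- t^-1 *: c); first by rewrite -[_ *: _]addr0; exact: CL.
    move: (submodZ t^-1 cH Hu); rewrite scalerDr scalerA mulVf // scale1r.
    by rewrite scaleNr opprK addrC.
  - by move=> c Cc; exists c, 0; rewrite scale0r addr0.
  - by exists 0, 1; rewrite scale1r add0r.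
by apply: na; exists a => //; rewrite subrr.
Qed.

(** Complements of H are chosen separately in the even and in the odd component, so that the
    resulting projection preserves parity. *)
Lemma graded_projection (K : numFieldType) (V : superspace K) (H : {pred V}) :
  submod_closed H -> graded_pred H ->
  exists pi : V -> V, [/\ linear pi,
    forall i x, x \in hcomp V i -> pi x \in hcomp V i,
    forall x, pi x \in H & forall x, x \in H -> pi x = x].
Proof.
move=> cH gH; have [H0 HL] := cH.
have [C0 [L0 A0 I0 S0]] := complement_exists (hcomp_closed V false) cH.
have [C1 [L1 A1 I1 S1]] := complement_exists (hcomp_closed V true) cH.
have Z0 : C0 0.
  have [|c Cc _] := S0 0; first by case: (hcomp_closed V false).
  by have := L0 (-1) _ _ Cc Cc; rewrite scaleN1r addNr.
have Z1 : C1 0.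
  have [|c Cc _] := S1 0; first by case: (hcomp_closed V true).
  by have := L1 (-1) _ _ Cc Cc; rewrite scaleN1r addNr.
pose C u := C0 (proj false u) /\ C1 (proj true u).
have CL k u v : C u -> C v -> C (k *: u + v).
  by move=> [? ?] [? ?]; split; rewrite proj_lin; [exact: L0 | exact: L1].
have CH u : C u -> u \in H -> u = 0.
  move=> [u0 u1] Hu; have e0 := I0 _ u0 (graded_proj false gH cH Hu).
  by have e1 := I1 _ u1 (graded_proj true gH cH Hu); rewrite (projE u) e0 e1 addr0.
have ex x : exists y, y \in H /\ C (x - y).
  have [c0 Cc0 h0] := S0 _ (proj_hom false x).
  have [c1 Cc1 h1] := S1 _ (proj_hom true x).
  exists ((proj false x - c0) + (proj true x - c1)); split; first exact: submodD.
  rewrite addrACA -projE -opprD subKr.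
  have e0 := A0 _ Cc0; have e1 := A1 _ Cc1.
  split; rewrite (linD (@proj_lin _ _ _)).
    by rewrite [proj _ c1]proj_other ?addr0 ?add0r ?proj_id.
  by rewrite [proj _ c0]proj_other ?addr0 ?add0r ?proj_id.
have uniq x y y' : y \in H -> C (x - y) -> y' \in H -> C (x - y') -> y = y'.
  move=> hy cy hy' cy'; apply/eqP; rewrite -subr_eq0; apply/eqP; apply: CH.
    by have := CL (-1) _ _ cy cy'; rewrite scaleN1r opprB addrA subrK.
  by apply: submodD => //; exact: submodN.
pose pi x := projT1 (cid (ex x)).
have piH x : pi x \in H by rewrite /pi; case: cid => y [].
have piC x : C (x - pi x) by rewrite /pi; case: cid => y [].
have piE x y : y \in H -> C (x - y) -> pi x = y by move=> hy cy; exact: uniq (piC x) hy cy.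
exists pi; split=> //.
- move=> k x y; apply: piE; first exact: HL.
  by rewrite opprD addrACA -scalerBr; exact: CL.
- move=> i x hx; have -> : pi x = proj i (pi x); last exact: proj_hom.
  apply: piE; first exact: graded_proj.
  have e : x - proj i (pi x) = proj i (x - pi x).
    by rewrite (linD (@proj_lin _ _ _)) (linN (@proj_lin _ _ _)) (proj_id hx).
  rewrite e; have [p0 p1] := piC x; have p := proj_hom i (x - pi x).
  case: i {hx e} p => p; split; rewrite ?(proj_id p) //; by rewrite proj_other.
- by move=> x hx; apply: piE => //; rewrite subrr; split; rewrite (lin0 (@proj_lin _ _ _)).
Qed.

(** * Functions on words that factor through U(g) *)

Section WordAction.
Variables (K : numFieldType) (g : lieSuperalgebra K) (D : algType K).
Local Notation letter := (letter g).

(** These are the conditions under which G descends to U(g); [env_val] says that the letter (i, x)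
    enters only through the component of x of parity i. *)
Record enveloping (G : seq letter -> D) : Prop := Enveloping {
  env_lin : multilinear G;
  env_val : forall a b i x, G (a ++ (i, proj i x) :: b) = G (a ++ (i, x) :: b);
  env_comm : forall a X Y b, G (a ++ X :: Y :: b) =
    lsign X Y *: G (a ++ Y :: X :: b) + G (a ++ lbr X Y :: b)
}.

(* Functions on words are functionals on U(g), and u acts by (u G)(a) = G(a u). *)
Fixpoint word_act (t : uterm g) (G : seq letter -> D) : seq letter -> D :=
  match t with
  | UGen x => fun a => G (a ++ [:: (false, x)]) + G (a ++ [:: (true, x)])
  | UZero => fun=> 0
  | UOne => G
  | UOpp s => fun a => - word_act s G a
  | UAdd s t => fun a => word_act s G a + word_act t G a
  | UScale k s => fun a => k *: word_act s G a
  | UMul s t => word_act s (word_act t G)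
  end.

Lemma word_act_lin t k G G' a : word_act t (fun a => k *: G a + G' a) a =
  k *: word_act t G a + word_act t G' a.
Proof.
elim: t G G' a => [x|||s hs|s hs t ht|c s hs|s hs t ht] G G' a //=.
- by rewrite scalerDr addrACA.
- by rewrite scaler0 addr0.
- by rewrite hs scalerN opprD.
- by rewrite hs ht scalerDr addrACA.
- by rewrite hs scalerDr !scalerA mulrC.
- rewrite -hs; congr (word_act s _ a); apply/funext => b; exact: ht.
Qed.

(** The action changes arguments and right multiplication changes values, so they commute. This
    turns G(a x) = G(a) alpha(x) into f(u x) = f(u) alpha(x). *)
Lemma word_act_mulr t G c a :
  word_act t (fun a => G a * c) a = word_act t G a * c.
Proof.
elim: t G a => [x|||s hs|s hs t ht|k s hs|s hs t ht] G a //=.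
- by rewrite mulrDl.
- by rewrite mul0r.
- by rewrite hs mulNr.
- by rewrite hs ht mulrDl.
- by rewrite hs scalerAl.
- rewrite -hs; congr (word_act s _ a); apply/funext => b; exact: ht.
Qed.

Lemma word_act_enveloping t G : enveloping G -> enveloping (word_act t G).
Proof.
elim: t G => [x|||s hs|s hs t ht|c s hs|s hs t ht] G [GL GV GC] //=.
- split.
  + move=> a b i k y z; rewrite -!catA /= !(GL a) scalerDr.
    by rewrite addrACA.
  + by move=> a b i y; rewrite -!catA /= !GV.
  + by move=> a X Y b; rewrite -!catA /= !(GC a X Y) scalerDr addrACA.
- by split=> [a b i k x y|//|a X Y b]; rewrite scaler0 addr0.
- have [sL sV sC] := hs _ (Enveloping GL GV GC); split=> [a b i k x y|a b i x|a X Y b].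
  + by rewrite sL scalerN opprD.
  + by rewrite sV.
  + by rewrite sC scalerN opprD.
- have [sL sV sC] := hs _ (Enveloping GL GV GC).
  have [tL tV tC] := ht _ (Enveloping GL GV GC); split=> [a b i k x y|a b i x|a X Y b].
  + by rewrite sL tL scalerDr addrACA.
  + by rewrite sV tV.
  + by rewrite sC tC scalerDr addrACA.
- have [sL sV sC] := hs _ (Enveloping GL GV GC); split=> [a b i k x y|a b i x|a X Y b].
  + by rewrite sL scalerDr !scalerA mulrC.
  + by rewrite sV.
  + by rewrite sC scalerDr !scalerA mulrC.
- exact/hs/ht.
Qed.

Lemma word_act_gen i x G a : enveloping G -> x \in hcomp g i ->
  word_act (UGen x) G a = G (a ++ [:: (i, x)]).
Proof.
move=> [GL GV _] hx /=.
have z : G (a ++ [:: (~~ i, x)]) = 0.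
  rewrite -GV proj_other ?negbK //; exact: (lin0 (GL a [::] (~~ i))).
by case: i hx z => _ /= ->; rewrite ?add0r ?addr0.
Qed.

(** G stays universally quantified in the induction because a product lets its left factor act on
    the transform of G by the right one, which is again enveloping. *)
Lemma word_act_eq s t G : ueq s t -> enveloping G -> word_act s G = word_act t G.
Proof.
move=> e; elim: e G => {s t} //=.
- by move=> s t _ h G /h.
- by move=> s t u _ h _ k G eG; rewrite h ?k.
- by move=> s s' _ h G /h ->.
- by move=> s s' t t' _ h _ k G eG; rewrite h ?k.
- by move=> a s s' _ h G /h ->.
- move=> s s' t t' _ h _ k G eG; rewrite k // h //; exact: word_act_enveloping.
- by move=> s t u G _; apply/funext => a; rewrite addrA.
- by move=> s t G _; apply/funext => a; rewrite addrC.
- by move=> s G _; apply/funext => a; rewrite add0r.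
- by move=> s G _; apply/funext => a; rewrite addNr.
- by move=> a b s G _; apply/funext => c; rewrite scalerA.
- by move=> s G _; apply/funext => a; rewrite scale1r.
- by move=> k s t G _; apply/funext => a; rewrite scalerDr.
- by move=> s k l G _; apply/funext => a; rewrite scalerDl.
- move=> s t u G _; apply/funext => a.
  rewrite -[X in _ = X + _]scale1r -word_act_lin; congr (word_act s _ a).
  by apply/funext => b; rewrite scale1r.
- move=> k s t G _; apply/funext => a; rewrite -[LHS]addr0.
  have z : word_act s (fun=> 0) a = 0.
    by rewrite -[RHS](mulr0 (word_act s G a)) -word_act_mulr;
      congr (word_act s _ a); apply/funext => b; rewrite mulr0.
  rewrite -[X in _ + X = _]z -word_act_lin; congr (word_act s _ a).
  by apply/funext => b; rewrite addr0.
- by move=> k x y G [GL _ _]; apply/funext => a; rewrite !GL scalerDr addrACA.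
move=> i j x y hx hy G eG; apply/funext => a.
have eG' z : enveloping (word_act (UGen z) G) by exact: word_act_enveloping.
rewrite -/(word_act (UGen (br x y)) G a) (word_act_gen _ eG (br_hom hx hy)).
rewrite -/(word_act (UGen x) (word_act (UGen y) G) a) (word_act_gen _ (eG' y) hx).
rewrite -/(word_act (UGen y) (word_act (UGen x) G) a) (word_act_gen _ (eG' x) hy).
rewrite (word_act_gen _ eG hx) (word_act_gen _ eG hy) -!catA /=.
rewrite [G (a ++ [:: _; _])](env_comm eG a (i, x)) addrC addrA.
rewrite /lsign /= addNr add0r /lbr /lval /= !proj_id //.
Qed.

End WordAction.

(** The part of Poincare-Birkhoff-Witt needed here: U(g) maps to D compatibly with right
    multiplication by h, so relations in g impose nothing beyond those of h. *)
Lemma uenv_retraction (K : numFieldType) (g : lieSuperalgebra K) (D : algType K)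
    (h : {pred g}) (alpha : g -> D) :
  submod_closed h -> graded_pred h ->
  (forall x y, x \in h -> y \in h -> br x y \in h) ->
  (forall k x y, x \in h -> y \in h -> alpha (k *: x + y) = k *: alpha x + alpha y) ->
  (forall i j x y, x \in h -> y \in h -> x \in hcomp g i -> y \in hcomp g j ->
    alpha (br x y) = alpha x * alpha y - ssign K i j *: (alpha y * alpha x)) ->
  exists f : uenv g -> D, [/\ linear f, f 1 = 1 &
    forall u x, x \in h -> f (u * uiota x) = f u * alpha x].
Proof.
move=> ch gh h_br aL a_br.
have [pi [pi_lin pi_hom pi_in pi_id]] := graded_projection ch gh.
(* The map alpha is linear on h only; composed with the projection it becomes linear on g, with
   unchanged values on h. *)
pose beta x := alpha (pi x).
have bL : linear beta by move=> k x y; rewrite /beta pi_lin aL.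
have b_br i j x y : x \in h -> y \in h -> x \in hcomp g i -> y \in hcomp g j ->
    beta (br x y) = beta x * beta y - ssign K i j *: (beta y * beta x).
  by move=> hx hy gx gy; rewrite /beta !pi_id ?(a_br i j) //; exact: h_br.
have [F FC] := compatible_exists h_br pi_lin pi_hom pi_in pi_id bL b_br.
(* Replacing each letter by its homogeneous component before applying F secures [env_val]. *)
pose nm (X : letter g) : letter g := (X.1, lval X).
have lval_nm X : lval (nm X) = lval X by apply: proj_id; exact: proj_hom.
have lbr_nm X Y : nm (lbr X Y) = lbr (nm X) (nm Y).
  by rewrite {1}/nm lval_lbr /lbr !lval_nm.
pose G w := F (map nm w).
have GE : enveloping G.
  split.
  - move=> a b i k x y; rewrite /G !map_cat /= /nm /lval /= proj_lin.
    exact: (cmp_lin (FC 0%N)).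
  - move=> a b i x; rewrite /G !map_cat /= /nm /lval /=.
    by rewrite [proj i (proj i x)]proj_id //; exact: proj_hom.
  - move=> a X Y b; rewrite /G !map_cat /= lbr_nm.
    exact: (cmp_comm (FC _) (leqnn _)).
pose f (u : uenv g) := word_act (urepr u) G [::].
have fpi t : f (upi t) = word_act t G [::].
  by rewrite /f (word_act_eq (urepr_upi t) GE).
exists f; split.
- by move=> k; elim/uind => s; elim/uind => t; rewrite -upiZ -upiD !fpi.
- by rewrite -[1]/(upi UOne) fpi /= /G /= (cmp_nil (FC 0%N)).
elim/uind=> t x hx; rewrite -upiM !fpi -word_act_mulr.
congr (word_act t _ [::]); apply/funext => a /=; rewrite /G !map_cat /=.
have hp i : proj i x \in h by exact: graded_proj.
have E i : F (map nm a ++ [:: nm (i, x)]) = F (map nm a) * beta (lval (i, proj i x)).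
  exact: (cmp_alpha (FC _) i (leqnn _) (hp i)).
rewrite !E -mulrDr; congr (_ * _).
rewrite /lval /= ![proj _ (proj _ _)]proj_id; try exact: proj_hom.
by rewrite -(linD bL) -projE /beta pi_id.
Qed.

(** * The Whittaker annihilator and reducibility *)

Section WhittakerBasics.
Variables (K : numFieldType) (g : lieSuperalgebra K) (p : gradedIdeal g).
Variable phi : lieHom p (ground_lie K).
Local Notation L := (whittaker_annihilator phi).

Let p_closed := gi_submod p.
Let p0 : 0 \in gi_pred p := p_closed.1.
Let pL := p_closed.2.

(* phi extended by zero outside p: only its values on p matter. *)
Definition phi_ext (x : g) : K := oapp (fun y : ideal_type p => phi y : K) 0 (insub x).

Lemma phi_extE (x : ideal_type p) : phi_ext (ival x) = phi x.
Proof. by rewrite /phi_ext valK. Qed.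

Lemma phi_ext_lin k x y : x \in gi_pred p -> y \in gi_pred p ->
  phi_ext (k *: x + y) = k * phi_ext x + phi_ext y.
Proof.
move=> hx hy; have := lh_lin phi k (IdealType hx) (IdealType hy).
by rewrite -!phi_extE.
Qed.

Lemma phi_ext0 : phi_ext 0 = 0.
Proof. by rewrite -[0 in LHS]/(ival (0 : ideal_type p)) phi_extE (lin0 (lh_lin phi)). Qed.

Lemma phi_extD x y : x \in gi_pred p -> y \in gi_pred p ->
  phi_ext (x + y) = phi_ext x + phi_ext y.
Proof. by move=> hx hy; rewrite -[x in LHS]scale1r phi_ext_lin // mul1r. Qed.

Lemma phi_ext_odd x : x \in hcomp g true -> phi_ext x = 0.
Proof.
rewrite /phi_ext; case: insubP => //= u _ <- hu.
by have := @lh_hom _ _ _ phi true u hu; rewrite inE => /eqP.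
Qed.

Definition phi_ker : {pred g} := [pred x | (x \in gi_pred p) && (phi_ext x == 0)].

Lemma phi_kerP x : reflect (x \in gi_pred p /\ phi_ext x = 0) (x \in phi_ker).
Proof. by rewrite inE; apply: (iffP andP) => -[h /eqP]. Qed.

Lemma phi_ker_closed : submod_closed phi_ker.
Proof.
split; first by apply/phi_kerP; rewrite phi_ext0.
move=> k u v /phi_kerP[pu eu] /phi_kerP[pv ev]; apply/phi_kerP; split; first exact: pL.
by rewrite phi_ext_lin // eu ev mulr0 addr0.
Qed.

Lemma br_proj_in (N : {pred g}) x y : submod_closed N ->
  (forall i j, br (proj i x) (proj j y) \in N) -> br x y \in N.
Proof.
move=> cN h; rewrite (projE x) (linD (@br_linl _ _ y)) (projE y).
by rewrite !(linD (@br_linr _ _ _)); do ![apply: submodD => //].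
Qed.

Lemma ideal_proj i x : x \in gi_pred p -> proj i x \in gi_pred p.
Proof. by apply: graded_proj => //; exact: gi_graded. Qed.

Lemma ideal_brr x y : x \in gi_pred p -> br x y \in gi_pred p.
Proof.
move=> hx; apply: br_proj_in => // i j.
rewrite (br_skew (proj_hom i x) (proj_hom j y)); apply: submodN => //.
by apply: submodZ => //; apply: gi_ideal; exact: ideal_proj.
Qed.

Lemma annihilatorP y :
  reflect (forall x, x \in gi_pred p -> br y x \in phi_ker) (y \in L).
Proof.
rewrite inE; apply: (iffP (asboolP _)) => h x.
  move=> hx; apply/phi_kerP; split; first exact: gi_ideal.
  by have := h (IdealType hx); rewrite -phi_extE.
by have /phi_kerP[_] := h _ (valP x); rewrite -phi_extE.
Qed.

Lemma annihilator_closed : submod_closed L.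
Proof.
split.
  apply/annihilatorP => x _; rewrite (lin0 (@br_linl _ _ x)).
  by case: phi_ker_closed.
move=> k u v /annihilatorP hu /annihilatorP hv; apply/annihilatorP => x hx.
rewrite br_linl; case: phi_ker_closed => _; apply; [exact: hu | exact: hv].
Qed.

Lemma phi_ker_odd x : x \in gi_pred p -> x \in hcomp g true -> x \in phi_ker.
Proof. by move=> px /phi_ext_odd e; apply/phi_kerP. Qed.

(** As phi kills odd elements, only brackets of components of equal parity matter, and such a
    bracket differs from one with y itself by an odd element of p. *)
Lemma annihilator_proj i y : y \in L -> proj i y \in L.
Proof.
move=> /annihilatorP hy; apply/annihilatorP => x hx.
have D j : br (proj i y) (proj j x) \in phi_ker.
  have hp := gi_ideal (proj i y) (ideal_proj j hx).
  have par := br_hom (proj_hom i y) (proj_hom j x).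
  have [e|ne] := eqVneq (i (+) j) true; first by apply: phi_ker_odd; rewrite -?e.
  have e : j = i by move: ne; case: i {hp par} => //; case: j.
  subst j; have -> : br (proj i y) (proj i x) =
      br y (proj i x) - br (proj (~~ i) y) (proj i x).
    rewrite {2}(projE y) (linD (@br_linl _ _ _)); case: (i).
      by rewrite addrC addKr.
    by rewrite addrK.
  have cK := phi_ker_closed; apply: submodD => //; first exact/hy/ideal_proj.
  apply: submodN => //; apply: phi_ker_odd; first exact/gi_ideal/ideal_proj.
  by have := br_hom (proj_hom (~~ i) y) (proj_hom i x); rewrite addNb addbb.
rewrite (projE x) (linD (@br_linr _ _ _)).
by apply: submodD => //; exact: phi_ker_closed.
Qed.

Lemma ideal_annihilator x : x \in gi_pred p -> x \in L.
Proof.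
move=> hx; apply/annihilatorP => y hy; apply/phi_kerP; split; first exact: gi_ideal.
have := lh_br phi (IdealType hx) (IdealType hy); rewrite /= -phi_extE /= => ->.
by [].
Qed.

Lemma annihilator_brl x y : x \in gi_pred p -> y \in L -> br x y \in phi_ker.
Proof.
move=> hx hy; have cK := phi_ker_closed; apply: br_proj_in => // i j.
rewrite (br_skew (proj_hom i x) (proj_hom j y)); apply: submodN => //.
apply: submodZ => //.
by have /annihilatorP := annihilator_proj j hy; apply; exact: ideal_proj.
Qed.

Lemma annihilator_br y z : y \in L -> z \in L -> br y z \in L.
Proof.
move=> hy hz; apply: br_proj_in => [|i j]; first exact: annihilator_closed.
have hy' := annihilator_proj i hy; have hz' := annihilator_proj j hz.
apply/annihilatorP => x hx.
have e := br_jacobi x (proj_hom i y) (proj_hom j z).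
have -> : br (br (proj i y) (proj j z)) x = br (proj i y) (br (proj j z) x) -
    ssign K i j *: br (proj j z) (br (proj i y) x) by rewrite e addrK.
have cK := phi_ker_closed; apply: submodD => //.
  by move/annihilatorP: hy'; apply; exact: gi_ideal.
apply: submodN => //; apply: submodZ => //.
by move/annihilatorP: hz'; apply; exact: gi_ideal.
Qed.

(** * A proper submodule from a homogeneous y in L outside p with phi([y, y]) = 0 *)

Section Reducible.
Variables (y : g) (i : bool).
Hypothesis yi : y \in hcomp g i.
Hypothesis yL : y \in L.
Hypothesis yp : y \notin gi_pred p.
Hypothesis yy : br y y \in phi_ker.

Definition line : {pred g} := [pred z | `[< exists a, z - a *: y \in gi_pred p >]].

Lemma lineP z : reflect (exists a, z - a *: y \in gi_pred p) (z \in line).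
Proof. by rewrite inE; exact: asboolP. Qed.

(** The coefficient of y in z, unique because y is not in p; the value 0 off [line] is a default. *)
Definition line_coord (z : g) : K :=
  if pselect (exists a, z - a *: y \in gi_pred p) is left e then projT1 (cid e) else 0.

Lemma line_coordE z a : z - a *: y \in gi_pred p -> line_coord z = a.
Proof.
move=> ha; rewrite /line_coord; case: pselect => [e|[]]; last by exists a.
case: cid => b /= hb; apply/eqP/negP => /negP ne; case/negP: yp.
have : (b - a)^-1 *: ((z - a *: y) - (z - b *: y)) \in gi_pred p.
  by apply: submodZ => //; apply: submodD => //; exact: submodN.
rewrite opprB [_ + (b *: y - z)]addrC addrA subrK -scalerBl scalerA mulVf ?scale1r //.
by rewrite subr_eq0.
Qed.

Definition line_rest z := z - line_coord z *: y.

Lemma line_restP z : z \in line -> line_rest z \in gi_pred p.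
Proof. by move=> /lineP [a ha]; rewrite /line_rest (line_coordE ha). Qed.

Lemma line_lin k u v : u \in line -> v \in line ->
  line_coord (k *: u + v) = k * line_coord u + line_coord v.
Proof.
move=> hu hv; apply: line_coordE; rewrite scalerDl opprD addrACA -scalerA -scalerBr.
by apply: pL; exact: line_restP.
Qed.

Lemma line_rest_lin k u v : u \in line -> v \in line ->
  line_rest (k *: u + v) = k *: line_rest u + line_rest v.
Proof.
move=> hu hv; rewrite /line_rest line_lin // scalerDl opprD addrACA -scalerA.
by rewrite -scalerBr.
Qed.

Lemma line_closed : submod_closed line.
Proof.
split; first by apply/lineP; exists 0; rewrite scale0r subr0.
move=> k u v hu hv; apply/lineP; exists (k * line_coord u + line_coord v).
rewrite scalerDl opprD addrACA -scalerA -scalerBr.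
by apply: pL; exact: line_restP.
Qed.

Lemma line_graded : graded_pred line.
Proof.
move=> z hz; exists (proj false z), (proj true z).
have H j : proj j z \in line.
  have hq := ideal_proj j (line_restP hz).
  move: hq; rewrite (linD (@proj_lin _ _ _)) (linN (@proj_lin _ _ _)).
  rewrite (linZ (@proj_lin _ _ _)) => hq; apply/lineP.
  have [e|ne] := eqVneq j i.
    by exists (line_coord z); move: hq; rewrite e (proj_id yi).
  exists 0; move: hq; rewrite [proj j y]proj_other ?scaler0 ?scale0r //.
  by move: ne yi; case: (j); case: (i).
by split; rewrite -?projE //; exact: proj_hom.
Qed.

(** Each of [p, p], [p, y], [y, p] and [y, y] lies in the kernel of phi, by the definition of L and
    the choice of y. *)
Lemma line_br u v : u \in line -> v \in line -> br u v \in phi_ker.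
Proof.
move=> /line_restP hu /line_restP hv; have cK := phi_ker_closed.
suff H q r a b : q \in gi_pred p -> r \in gi_pred p ->
    br (q + a *: y) (r + b *: y) \in phi_ker.
  by have := H _ _ (line_coord u) (line_coord v) hu hv; rewrite !subrK.
move=> hq hr; rewrite (linD (@br_linl _ _ _)) (linZ (@br_linl _ _ _)).
rewrite !(linD (@br_linr _ _ _)) !(linZ (@br_linr _ _ _)).
have h1 := annihilator_brl hq (ideal_annihilator hr).
have h2 := annihilatorP _ yL _ hr; have h3 := annihilator_brl hq yL.
apply: submodD => //; first by apply: submodD => //; exact: submodZ.
by apply: submodZ => //; apply: submodD => //; exact: submodZ.
Qed.

Lemma phi_ker_line x : x \in phi_ker -> x \in line.
Proof. by move=> /phi_kerP[px _]; apply/lineP; exists 0; rewrite scale0r subr0. Qed.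

Let nil2 : 'M[K]_2 := delta_mx 0 1.

Lemma nil2_sq : nil2 * nil2 = 0.
Proof. by rewrite /nil2 -mulmxE mul_delta_mx_cond. Qed.

Lemma nil2_neq0 : nil2 <> 0.
Proof. by move=> /matrixP /(_ 0 1); rewrite !mxE /= => /eqP; rewrite oner_eq0. Qed.

Definition line_rep (z : g) : 'M[K]_2 :=
  phi_ext (line_rest z) *: 1 + line_coord z *: nil2.

Lemma line_repM u v : line_rep u * line_rep v =
  (phi_ext (line_rest u) * phi_ext (line_rest v)) *: 1 +
  (phi_ext (line_rest u) * line_coord v + line_coord u * phi_ext (line_rest v)) *: nil2.
Proof.
rewrite /line_rep mulrDl !mulrDr -!scalerAl -!scalerAr !mul1r mulr1 nil2_sq.
by rewrite !scaler0 addr0 !scalerA -addrA -scalerDl.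
Qed.

Lemma line_rest_odd z : z \in line -> z \in hcomp g true -> phi_ext (line_rest z) = 0.
Proof.
move=> hz z1; have [i1|i0] := boolP i.
  apply: phi_ext_odd; have c1 := hcomp_closed g true; apply: submodD => //.
  by apply: submodN => //; apply: submodZ => //; rewrite -i1.
have : proj true (line_rest z) \in gi_pred p by apply: ideal_proj; exact: line_restP.
rewrite (linD (@proj_lin _ _ _)) (linN (@proj_lin _ _ _)) (linZ (@proj_lin _ _ _)).
rewrite (proj_id z1) [proj _ y]proj_other; last by move: i0 yi; case: (i).
rewrite scaler0 => hz0; rewrite /line_rest (@line_coordE _ 0) ?scale0r //.
by rewrite subr0 phi_ext_odd.
Qed.

(** The left side vanishes by [line_br]. The matrices commute, which settles the cases with an even
    argument; for two odd arguments phi vanishes and the square-zero matrix makes both products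
    0. *)
Lemma line_rep_br j k u v : u \in line -> v \in line ->
  u \in hcomp g j -> v \in hcomp g k ->
  line_rep (br u v) = line_rep u * line_rep v - ssign K j k *: (line_rep v * line_rep u).
Proof.
move=> hu hv uj vk; have /phi_kerP[pb eb] := line_br hu hv.
have cb : line_coord (br u v) = 0 by apply: line_coordE; rewrite scale0r subr0.
rewrite {1}/line_rep /line_rest cb !scale0r subr0 eb scale0r addr0 !line_repM.
have [/andP[j1 k1]|njk] := boolP (j && k).
  rewrite (line_rest_odd hu) -?j1 // (line_rest_odd hv) -?k1 //.
  by rewrite !(mul0r, mulr0, addr0, scale0r, scaler0, subr0).
rewrite /ssign (negbTE njk) expr0 scale1r.
move: (phi_ext (line_rest u)) (phi_ext (line_rest v)) (line_coord u) (line_coord v).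
move=> a b c d; rewrite [b * a]mulrC [b * c]mulrC [d * a]mulrC.
by rewrite [c * b + _]addrC subrr.
Qed.

Local Notation ipw := (@ipure K p g (ideal_incl p) (char_module phi)).

(** The retraction f descends to a map psi from W(phi) to 2 x 2 matrices, which separates w from the
    submodule U(g) y w and shows y w to be nonzero. *)
Lemma whittaker_reducible : ~ irreducible (whittaker_module phi).
Proof.
move=> irr.
have [|||k u v hu hv||f [fL f1 fx]] := @uenv_retraction K g 'M[K]_2 line line_rep.
- exact: line_closed.
- exact: line_graded.
- by move=> u v hu hv; apply: phi_ker_line; exact: line_br.
- rewrite /line_rep line_rest_lin // line_lin // phi_ext_lin; try exact: line_restP.
  by rewrite !scalerDl scalerDr !scalerA addrACA.
- exact: line_rep_br.
pose q (b : uenv g) (c : ground_superspace K) : 'M[K]_2 := (c : K) *: f b.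
have qDl b b' c : q (b + b') c = q b c + q b' c by rewrite /q (linD fL) scalerDr.
have qDr b c c' : q b (c + c') = q b c + q b c' by rewrite /q scalerDl.
have rep_p x : x \in gi_pred p -> line_rep x = phi_ext x *: 1.
  move=> px; have c0 : line_coord x = 0 by apply: line_coordE; rewrite scale0r subr0.
  by rewrite /line_rep /line_rest c0 !scale0r subr0 addr0.
have qA b (a : uenv p) c : q (b * umap (ideal_incl p) a) c =
    q b (@uact K p (char_module phi) a c).
  rewrite /q; elim/uind: a b c; elim=> [x|||s hs|s hs t ht|k s hs|s hs t ht] b c.
  - rewrite -[upi _]/(uiota x) umap_iota uact_iota /= fx; last first.
      by apply/lineP; exists 0; rewrite scale0r subr0; exact: valP.
    rewrite rep_p; last exact: valP.
    by rewrite phi_extE -scalerAr mulr1 scalerA mulrC.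
  - by rewrite uact_pi /= -[upi _]/(0 : uenv p) (lin0 (@umap_lin _ _ _ _)) mulr0
      (lin0 fL) scaler0 scale0r.
  - by rewrite uact_pi /= -[upi _]/(1 : uenv p) umap1 mulr1.
  - by rewrite upiN (linN (@umap_lin _ _ _ _)) mulrN (linN fL) scalerN hs
      (linN (@uact_linl _ _ _ _)) scaleNr.
  - by rewrite upiD (linD (@umap_lin _ _ _ _)) mulrDr (linD fL) scalerDr hs ht
      (linD (@uact_linl _ _ _ _)) scalerDl.
  - by rewrite upiZ (linZ (@umap_lin _ _ _ _)) -scalerAr (linZ fL) scalerA mulrC -scalerA hs
      (linZ (@uact_linl _ _ _ _)) scalerA.
  - by rewrite upiM umapM mulrA ht hs uactM.
pose psi : whittaker_module phi -> 'M[K]_2 := tlift q.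
have psiE b c : psi (ipw b c) = q b c by exact: (tlift_pure qDl qDr qA).
have rep_y : line_rep y = nil2.
  have c1 : line_coord y = 1 by apply: line_coordE; rewrite scale1r subrr.
  by rewrite /line_rep /line_rest c1 !scale1r subrr phi_ext0 scale0r add0r.
have yline : y \in line by apply/lineP; exists 1; rewrite scale1r subrr.
pose N : {pred whittaker_module phi} :=
  [pred m | `[< exists u, m = ipw (u * uiota y) 1 >]].
have NP m : reflect (exists u, m = ipw (u * uiota y) 1) (m \in N).
  by rewrite inE; exact: asboolP.
have Nsub : subsupermodule N.
  split.
  - split; first by apply/NP; exists 0; rewrite mul0r ipure0l.
    move=> k _ _ /NP[u ->] /NP[v ->]; apply/NP; exists (k *: u + v).
    by rewrite mulrDl -scalerAl ipureDl ipureZl.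
  - move=> _ /NP[u ->]; have [u0 [u1 [h0 h1 ->]]] := uhcomp_sum u.
    have P j (w : uenv g) : w \in uhcomp g j ->
        ipw (w * uiota y) 1 \in hcomp (whittaker_module phi) (j (+) i).
      move=> hw; rewrite -[j (+) i]addbF; apply: ind_hcomp_pure => //.
      by apply: uhcompM => //; exact: uhcomp_iota.
    have n w : ipw (w * uiota y) 1 \in N by apply/NP; exists w.
    have := P _ _ h0; have := P _ _ h1; rewrite mulrDl ipureDl.
    case: (i) => p1 p0'.
      exists (ipw (u1 * uiota y) 1), (ipw (u0 * uiota y) 1).
      by split=> //; rewrite addrC.
    by exists (ipw (u0 * uiota y) 1), (ipw (u1 * uiota y) 1).
  - move=> x _ /NP[u ->]; apply/NP; exists (uiota x * u).
    by rewrite /= /ind_act tact_pure mulrA.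
have [N0|Nall] := irr N Nsub.
  have /N0 e : ipw (1 * uiota y) 1 \in N by apply/NP; exists 1.
  have := psiE (1 * uiota y) 1; rewrite e /q fx // f1 mul1r rep_y scale1r => e'.
  by apply: nil2_neq0; rewrite -e'; exact: (tlift0 qDl qDr qA).
(* If w = u y w, then 1 = f(u) n for the square-zero matrix n; right multiplication by n gives n =
   0. *)
have /NP[u e] := Nall (ipw 1 1).
have := psiE 1 1; rewrite e psiE /q fx // f1 rep_y !scale1r => e'.
by apply: nil2_neq0; rewrite -[nil2]mul1r -e' -mulrA nil2_sq mulr0.
Qed.

End Reducible.
End WhittakerBasics.

(** * The Euler operator *)

Section EulerOperator.
Variables (K : numFieldType) (g : lieSuperalgebra K) (p : gradedIdeal g).
Variable phi : lieHom p (ground_lie K).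
Local Notation L := (whittaker_annihilator phi).
Local Notation phi_ext := (phi_ext phi).

Variables (M : supermodule g) (V0 : {pred M}).
Hypothesis V0c : submod_closed V0.
Hypothesis V0L : forall z v, z \in L -> v \in V0 -> sact z v \in V0.
Hypothesis V0p : forall x v, x \in gi_pred p -> v \in V0 -> sact x v = phi_ext x *: v.

(** The space U_d(g) V0, with U_d(g) spanned by the products of at most d letters. *)
Fixpoint fil (d : nat) : {pred M} :=
  if d is d'.+1 then
    span_of (fun m => m \in fil d' \/ exists x u, u \in fil d' /\ m = sact x u)
  else V0.

Lemma fil_closed d : submod_closed (fil d).
Proof. by case: d => //= d; exact: span_of_closed. Qed.

Lemma filS d u : u \in fil d -> u \in fil d.+1.
Proof. by move=> hu; apply: span_of_gen; left. Qed.

Lemma fil_act d x u : u \in fil d -> sact x u \in fil d.+1.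
Proof. by move=> hu; apply: span_of_gen; right; exists x, u. Qed.

Lemma fil_ind d (P : M -> Prop) : P 0 ->
  (forall a u v, P u -> P v -> P (a *: u + v)) ->
  (forall u, u \in fil d -> P u) ->
  (forall i x u, x \in hcomp g i -> u \in fil d -> P (sact x u)) ->
  forall v, v \in fil d.+1 -> P v.
Proof.
move=> P0 PL Pf Pa; apply: span_of_ind => // _ [/Pf //|[x [u [hu ->]]]].
rewrite (projE x) (linD (@sact_linl _ _ _ u)) -[sact _ _]scale1r.
by apply: PL; apply: (Pa _ _ _ (proj_hom _ x)).
Qed.

Definition low (d : nat) : {pred M} := if d is d'.+1 then fil d' else pred1 0.

Lemma low_fil d u : u \in low d -> u \in fil d.
Proof.
by case: d => [|d]; [rewrite inE => /eqP ->; case: V0c | exact: filS].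
Qed.

Lemma low_act d x u : u \in low d -> sact x u \in fil d.
Proof.
case: d => [|d]; last exact: fil_act.
by rewrite inE => /eqP ->; rewrite (lin0 (@sact_linr _ _ _ x)); case: V0c.
Qed.

Lemma sact_swap i j x y (m : M) : x \in hcomp g i -> y \in hcomp g j ->
  sact x (sact y m) = sact (br x y) m + ssign K i j *: sact y (sact x m).
Proof. by move=> hx hy; rewrite (sact_br m hx hy) subrK. Qed.

(** Moving z past a letter x leaves [z, x], a single letter applied one degree lower; at the bottom
    L preserves V0. *)
Lemma fil_annihilator d z u : z \in L -> u \in fil d -> sact z u \in fil d.
Proof.
elim: d z u => [|d IH] z u hz; first exact: V0L.
have c := fil_closed d.+1; have [c0 cL] := c.
suff H i z' : z' \in L -> z' \in hcomp g i -> u \in fil d.+1 -> sact z' u \in fil d.+1.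
  move=> hu; rewrite (projE z) (linD (@sact_linl _ _ _ u)).
  by apply: submodD => //; apply: (H _ _ _ (proj_hom _ z) hu); exact: annihilator_proj.
move=> hz' zi; move: u; apply: fil_ind.
- by rewrite (lin0 (@sact_linr _ _ _ z')).
- by move=> a u v hu hv; rewrite sact_linr; exact: cL.
- by move=> u hu; apply: filS; exact: IH.
move=> j x u hx hu; rewrite (sact_swap u zi hx); apply: submodD => //.
  exact: fil_act.
by apply: submodZ => //; apply: fil_act; exact: IH.
Qed.

Definition dev (x : g) (m : M) : M := sact x m - phi_ext x *: m.

Lemma dev_lin x : linear (dev x).
Proof.
move=> a u v; rewrite /dev sact_linr scalerDr scalerBr opprD addrACA !scalerA.
by rewrite [a * _]mulrC.
Qed.

Lemma dev_act i j x y u : x \in hcomp g i -> y \in hcomp g j ->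
  dev x (sact y u) = sact (br x y) u + ssign K i j *: sact y (dev x u).
Proof.
move=> hx hy; rewrite /dev (sact_swap u hx hy) (linD (@sact_linr _ _ _ y)).
rewrite (linN (@sact_linr _ _ _ y)) (linZ (@sact_linr _ _ _ y)) scalerBr -addrA.
congr (_ + (_ - _)); case: i hx => hx; last by rewrite /ssign scale1r.
by rewrite (phi_ext_odd phi hx) !scale0r scaler0.
Qed.

(** Moving x past a letter y leaves [x, y], which is in p, hence in L, and so does not raise the
    degree. *)
Lemma dev_low d x u : x \in gi_pred p -> u \in fil d -> dev x u \in low d.
Proof.
elim: d x u => [|d IH] x u hx; first by move=> hu; rewrite inE /dev V0p // subrr.
have c := fil_closed d; have [c0 cL] := c.
suff H i x' : x' \in gi_pred p -> x' \in hcomp g i -> u \in fil d.+1 -> dev x' u \in fil d.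
  move=> hu; have -> : dev x u = dev (proj false x) u + dev (proj true x) u.
    have es : sact x u = sact (proj false x) u + sact (proj true x) u.
      by rewrite -(linD (@sact_linl _ _ _ u)) -projE.
    have ep : phi_ext x = phi_ext (proj false x) + phi_ext (proj true x).
      by rewrite -phi_extD -?projE //; exact: ideal_proj.
    by rewrite /dev es ep scalerDl opprD addrACA.
  by apply: submodD => //; apply: (H _ _ _ (proj_hom _ x) hu); exact: ideal_proj.
move=> hx' xi; move: u; apply: fil_ind.
- by rewrite (lin0 (dev_lin _)).
- by move=> a u v hu hv; rewrite dev_lin; exact: cL.
- by move=> u hu; apply: low_fil; exact: IH.
move=> j y u hy hu; rewrite (dev_act u xi hy); apply: submodD => //.
  by apply: fil_annihilator => //; apply: ideal_annihilator; exact: ideal_brr.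
by apply: submodZ => //; apply: low_act; exact: IH.
Qed.

Local Notation triple := (bool * g * g)%type.
Implicit Types (t : triple) (s : seq triple).

(** A triple consists of a parity, a vector e of g and a partner q in p of the same parity. Duality
    enters through [residue]: that [residue s x] lies in L means that the vectors e recover x modulo
    L from the numbers phi([x, q]). *)
Definition dual_system s := forall t, t \in s ->
  [/\ t.1.2 \in hcomp g t.1.1, t.2 \in gi_pred p & t.2 \in hcomp g t.1.1].

Definition euler_term t (m : M) : M := - (-1) ^+ t.1.1 *: sact t.1.2 (dev t.2 m).
Definition euler s (m : M) : M := \sum_(t <- s) euler_term t m.
Definition residue s (x : g) : g := x - \sum_(t <- s) phi_ext (br x t.2) *: t.1.2.

Lemma euler_lin s : linear (euler s).
Proof.
move=> a u v; rewrite /euler scaler_sumr -big_split; apply: eq_bigr => t _ /=.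
by rewrite /euler_term dev_lin sact_linr scalerDr !scalerA mulrC.
Qed.

(** Moving the term past x leaves phi([x, q]) e; the other two commutators contain a factor [dev],
    which pays for the extra letter. *)
Lemma euler_term_act d j t x u : dual_system [:: t] -> x \in hcomp g j -> u \in fil d ->
  euler_term t (sact x u) - phi_ext (br x t.2) *: sact t.1.2 u -
    sact x (euler_term t u) \in fil d.
Proof.
case: t => -[i e] q /(_ (i, e, q)); rewrite mem_head /= => /(_ isT) [ei qp qi] xj hu.
have c := fil_closed d.
have qx : br x q \in gi_pred p by exact: gi_ideal.
rewrite /euler_term /= (dev_act u qi xj) (br_skew qi xj) (linN (@sact_linl _ _ _ u)).
rewrite (linZ (@sact_linl _ _ _ u)) (linD (@sact_linr _ _ _ e)) (linN (@sact_linr _ _ _ e)).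
rewrite !(linZ (@sact_linr _ _ _ _)) (sact_swap _ ei xj).
have -> : sact (br x q) u = phi_ext (br x q) *: u + dev (br x q) u by rewrite addrC subrK.
rewrite (linD (@sact_linr _ _ _ e)) (linZ (@sact_linr _ _ _ e)).
set A := sact e u; set B := sact e (dev (br x q) u).
set C := sact (br e x) (dev q u); set D := sact x (sact e (dev q u)).
have hB : B \in fil d by apply: low_act; exact: dev_low.
have hC : C \in fil d by apply: low_act; exact: dev_low.
have sg : ssign K i j * ssign K i j = 1 by rewrite /ssign -signr_addb addbb.
(* Unless e and x have equal parity, [x, q] is odd and phi kills it; for equal parities the two
   signs coincide. *)
have ph : (-1) ^+ i * ssign K i j * phi_ext (br x q) = phi_ext (br x q).
  have [eij|ne] := eqVneq i j.
    by rewrite eij /ssign andbb -signr_addb addbb mul1r.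
  rewrite (phi_ext_odd phi) ?mulr0 //; have := br_hom xj qi.
  by case: (i) ne; case: (j).
rewrite !(scalerDr, scalerN, scaleNr, opprK, scalerA) ph.
rewrite -[_ * ssign K i j * ssign K i j]mulrA sg mulr1.
set a := (-1) ^+ i * ssign K i j.
rewrite opprD opprK opprD !addrA [X in X \in _](ACl (2*3*(1*5)*(6*4))) /= !subrr !addr0.
by apply: submodD; rewrite -?scalerN //; apply: submodZ => //; exact: submodN.
Qed.

Lemma euler_act d j s x u : dual_system s -> x \in hcomp g j -> u \in fil d ->
  euler s (sact x u) - sact (x - residue s x) u - sact x (euler s u) \in fil d.
Proof.
move=> hs xj hu; rewrite subKr; have [c0 cL] := fil_closed d.
have -> : sact (\sum_(t <- s) phi_ext (br x t.2) *: t.1.2) u =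
    \sum_(t <- s) phi_ext (br x t.2) *: sact t.1.2 u.
  elim: (s) => [|t s' IH]; first by rewrite !big_nil (lin0 (@sact_linl _ _ _ u)).
  by rewrite !big_cons (sact_linl u) IH.
have -> : sact x (euler s u) = \sum_(t <- s) sact x (euler_term t u).
  elim: (s) => [|t s' IH]; first by rewrite /euler !big_nil (lin0 (@sact_linr _ _ _ x)).
  by rewrite /euler !big_cons (linD (@sact_linr _ _ _ x)) IH.
rewrite -!sumrB big_seq; apply: (big_ind (fun m => m \in fil d)) => //.
  by move=> m m' hm hm'; apply: submodD.
move=> t ts; apply: (euler_term_act _ xj hu) => t'.
by rewrite inE => /eqP ->; exact: hs.
Qed.

(* Modulo lower filtration degree, every dual system whose span covers the
   finitely many letters occurring in v acts on v as the degree operator. *)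
Lemma euler_degree d v : v \in fil d -> exists2 xs : seq g,
  (forall x, x \in xs -> exists i, x \in hcomp g i) &
  forall s, dual_system s -> (forall x, x \in xs -> residue s x \in L) ->
    euler s v - d%:R *: v \in low d.
Proof.
elim: d v => [|d IH].
  move=> v hv; exists [::] => // s hs _; rewrite scale0r subr0 inE /euler.
  rewrite big_seq big1 // => t /hs [_ tp _].
  have /eqP e : dev t.2 v \in low 0 by exact: dev_low.
  by rewrite /euler_term e (lin0 (@sact_linr _ _ _ _)) scaler0.
have c := fil_closed d; have [c0 cL] := c.
apply: fil_ind.
- by exists [::] => // s _ _; rewrite (lin0 (euler_lin s)) scaler0 subr0.
- move=> a u v [xs hx hxs] [ys hy hys]; exists (xs ++ ys).
    by move=> x; rewrite mem_cat => /orP[/hx|/hy].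
  move=> s hs h.
  have hu : euler s u - d.+1%:R *: u \in fil d.
    by apply: hxs => // x xx; apply: h; rewrite mem_cat xx.
  have hv : euler s v - d.+1%:R *: v \in fil d.
    by apply: hys => // x xx; apply: h; rewrite mem_cat xx orbT.
  have := cL a _ _ hu hv; rewrite euler_lin scalerBr scalerDr !scalerA addrACA -opprD.
  by rewrite [a * _]mulrC.
- move=> u hu; have [xs hx hxs] := IH _ hu; exists xs => // s hs h.
  rewrite -natr1 scalerDl scale1r opprD addrA; apply: submodD => //.
    by apply: low_fil; exact: hxs.
  exact: submodN.
(* The letter x is recorded so that its residue lies in L and keeps u in degree d. Modulo that
   degree, moving the Euler operator past x adds one copy of x u, raising the eigenvalue from d to d
   + 1. *)
move=> i x u xi hu; have [xs hx hxs] := IH _ hu; exists (x :: xs).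
  by move=> y; rewrite inE => /orP[/eqP ->|/hx //]; exists i.
move=> s hs h.
have h1 := euler_act hs xi hu.
have h2 : sact (residue s x) u \in fil d.
  by apply: fil_annihilator => //; apply: h; rewrite mem_head.
have h3 : sact x (euler s u - d%:R *: u) \in fil d.
  by apply: low_act; apply: hxs => // y yy; apply: h; rewrite inE yy orbT.
have := submodD c (submodD c h1 (submodN c h2)) h3.
rewrite (linD (@sact_linl _ _ _ u)) (linN (@sact_linl _ _ _ u)).
rewrite (linD (@sact_linr _ _ _ x)) (linN (@sact_linr _ _ _ x)).
rewrite (linZ (@sact_linr _ _ _ x)) -natr1 scalerDl scale1r !opprD opprK !addrA.
set A := euler s _; set B := sact x u; set C := sact x (euler s u).
set E := sact (residue s x) u.
by rewrite [X in X \in fil d -> _](ACl (1*7*2*(3*5)*(6*4))) /= !subrr !addr0.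
Qed.

Lemma phi_ext_sum (I : eqType) (r : seq I) (a : I -> K) (x : I -> g) :
  (forall i, i \in r -> x i \in gi_pred p) ->
  (\sum_(i <- r) a i *: x i \in gi_pred p) *
  (phi_ext (\sum_(i <- r) a i *: x i) = \sum_(i <- r) a i * phi_ext (x i)).
Proof.
elim: r => [|i r IH] h.
  by rewrite !big_nil phi_ext0; split=> //; case: (gi_submod p).
have hi := h i (mem_head _ _).
have [h1 h2] := IH (fun j jr => h j (mem_behead (s := i :: r) jr)).
rewrite !big_cons phi_ext_lin // h2; split=> //.
by case: (gi_submod p) => _; apply.
Qed.

(** A Gram-Schmidt induction for the pairing phi([x, q]): if the residue z of the new letter is not
    in L, it pairs nontrivially with some q in p, and the pair made of z and q, suitably normalised,
    is added. *)
Lemma dual_system_exists (xs : seq g) :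
  (forall x, x \in xs -> exists i, x \in hcomp g i) ->
  exists2 s, dual_system s & forall x, x \in xs -> residue s x \in L.
Proof.
elim: xs => [|x xs IH] hxs; first by exists [::].
have [s hs hr] := IH (fun y yx => hxs y (mem_behead (s := x :: xs) yx)).
have [j xj] := hxs x (mem_head _ _).
set z := residue s x.
have [zL|zL] := boolP (z \in L).
  by exists s => // y; rewrite inE => /orP[/eqP -> //|/hr].
have term_hom (y y' e : g) i k : y \in hcomp g k -> y' \in hcomp g i ->
    e \in hcomp g i -> phi_ext (br y y') *: e \in hcomp g k.
  move=> yk yi ei; have ck := hcomp_closed g k.
  have [e'|ne] := eqVneq i k; first by apply: submodZ => //; rewrite -e'.
  rewrite phi_ext_odd ?scale0r; first by case: ck.
  by have := br_hom yk yi; case: (i) ne; case: (k).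
have zj : z \in hcomp g j.
  have cj := hcomp_closed g j; apply: submodD => //; apply: submodN => //.
  rewrite big_seq; apply: (big_ind (fun y => y \in hcomp g j)); first by case: cj.
    by move=> *; exact: submodD.
  by move=> t /hs [t1 t2 t3]; exact: (term_hom _ _ _ t.1.1).
(* Only the component of q having the parity of z contributes to phi([z, q]), so q can be taken
   homogeneous. *)
have [q qp [qj qz]] : exists2 q, q \in gi_pred p &
    q \in hcomp g j /\ phi_ext (br z q) != 0.
  apply: contrapT => nq; case/negP: zL; apply/annihilatorP => q qp.
  have H i : br z (proj i q) \in phi_ker phi.
    apply/phi_kerP; split; first exact/gi_ideal/ideal_proj.
    have [e|ne] := eqVneq i j.
      apply/eqP/negP => /negP ne; apply: nq; exists (proj i q); first exact: ideal_proj.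
      by split=> //; rewrite -e; exact: proj_hom.
    rewrite phi_ext_odd //; have := br_hom zj (proj_hom i q).
    by case: (i) ne; case: (j).
  rewrite (projE q) (linD (@br_linr _ _ z)).
  by apply: submodD => //; exact: phi_ker_closed.
set c := phi_ext (br z q) in qz.
pose q' := q - \sum_(t <- s) phi_ext (br t.1.2 q) *: t.2.
have [sp _] := phi_ext_sum (fun t => phi_ext (br t.1.2 q))
  (fun t ts => let: And3 _ h _ := hs t ts in h).
have q'p : q' \in gi_pred p.
  by have cp := gi_submod p; apply: submodD => //; exact: submodN.
have q'j : q' \in hcomp g j.
  have cj := hcomp_closed g j; apply: submodD => //; apply: submodN => //.
  rewrite big_seq; apply: (big_ind (fun y => y \in hcomp g j)); first by case: cj.
    by move=> *; exact: submodD.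
  move=> t /hs [t1 t2 t3]; have [e'|ne] := eqVneq t.1.1 j.
    by apply: submodZ => //; rewrite -e'.
  rewrite phi_ext_odd ?scale0r; first by case: cj.
  by have := br_hom t1 qj; case: (t.1.1) ne; case: (j).
(* The correction makes q' orthogonal to the letters treated so far. *)
have q'E y : phi_ext (br y q') = phi_ext (br (residue s y) q).
  have brp u v : v \in gi_pred p -> br u v \in gi_pred p by exact: gi_ideal.
  rewrite /q' /residue (linD (@br_linr _ _ y)) (linN (@br_linr _ _ y)).
  rewrite (linD (@br_linl _ _ q)) (linN (@br_linl _ _ q)).
  have -> : br y (\sum_(t <- s) phi_ext (br t.1.2 q) *: t.2) =
      \sum_(t <- s) phi_ext (br t.1.2 q) *: br y t.2.
    elim: (s) => [|t s' IHs]; first by rewrite !big_nil (lin0 (@br_linr _ _ y)).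
    by rewrite !big_cons br_linr IHs.
  have -> : br (\sum_(t <- s) phi_ext (br y t.2) *: t.1.2) q =
      \sum_(t <- s) phi_ext (br y t.2) *: br t.1.2 q.
    elim: (s) => [|t s' IHs]; first by rewrite !big_nil (lin0 (@br_linl _ _ q)).
    by rewrite !big_cons br_linl IHs.
  have [p1 e1] := @phi_ext_sum _ s (fun t => phi_ext (br t.1.2 q)) (fun t => br y t.2)
    (fun t ts => let: And3 _ h _ := hs t ts in brp y _ h).
  have [p2 e2] := @phi_ext_sum _ s (fun t => phi_ext (br y t.2)) (fun t => br t.1.2 q)
    (fun t _ => brp _ _ qp).
  have yq := brp y q qp.
  rewrite ![br y q - _]addrC -!scaleN1r !phi_ext_lin // e1 e2.
  by congr (_ * _ + _); apply: eq_bigr => t _; rewrite mulrC.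
exists ((j, c^-1 *: z, q') :: s).
  move=> t; rewrite inE => /orP[/eqP -> /=|/hs //]; split=> //.
  by apply: submodZ => //; exact: hcomp_closed.
(* The new term subtracts a multiple of z: this kills the residue z of x and leaves unchanged the
   earlier residues, which lie in L. *)
have resE y : residue ((j, c^-1 *: z, q') :: s) y =
    residue s y - (phi_ext (br (residue s y) q) / c) *: z.
  by rewrite /residue big_cons /= q'E opprD addrCA addrC scalerA.
have [L0 _] := annihilator_closed phi.
move=> y; rewrite inE => /orP[/eqP -> |yxs]; rewrite resE.
  by rewrite -/z -/c divff // scale1r subrr.
have := hr _ yxs; move: (residue s y) => r rL.
have /phi_kerP[_ ->] : br r q \in phi_ker phi by move/annihilatorP: rL; exact.
by rewrite mul0r scale0r subr0.
Qed.

(** Descent on the degree. If some x - phi(x) does not kill v, its image has lower degree. Otherwise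
    the Euler operator kills v, so a positive multiple of v, and hence v, already has lower
    degree. *)
Lemma fil_meet (N : {pred M}) d v : submod_closed N ->
  (forall x m, m \in N -> sact x m \in N) -> v \in fil d -> v \in N -> v != 0 ->
  exists2 u, u \in V0 & u \in N /\ u != 0.
Proof.
move=> cN aN; elim: d v => [|d IH] v vd vN v0; first by exists v.
have [[x [xp xv]]|nx] := pselect (exists x, x \in gi_pred p /\ dev x v != 0).
  apply: (IH (dev x v)) => //; first exact: (dev_low xp vd).
  by apply: submodD => //; [exact: aN | apply: submodN => //; exact: submodZ].
have [xs hx hxs] := euler_degree vd.
have [s hs hr] := dual_system_exists hx.
have := hxs s hs hr; have -> : euler s v = 0.
  rewrite /euler big_seq big1 // => t /hs [_ tp _].
  have e : dev t.2 v = 0.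
    by apply/eqP/negP => /negP ne; apply: nx; exists t.2.
  by rewrite /euler_term e (lin0 (@sact_linr _ _ _ _)) scaler0.
rewrite sub0r => h; apply: (IH v) => //.
have c := fil_closed d; have := submodZ (- d.+1%:R^-1) c h.
by rewrite scalerN scaleNr opprK scalerA mulVf ?scale1r // pnatr_eq0.
Qed.

End EulerOperator.

(** * The even generator w of W(phi) *)

Section WhittakerVector.
Variables (K : numFieldType) (g : lieSuperalgebra K) (p : gradedIdeal g).
Variable phi : lieHom p (ground_lie K).
Local Notation W := (whittaker_module phi).
Local Notation ipw := (@ipure K p g (ideal_incl p) (char_module phi)).

Definition wvec : W := ipw 1 1.

Lemma wvec_generates (N : {pred W}) : submod_closed N ->
  (forall x m, m \in N -> sact x m \in N) -> wvec \in N -> forall m, m \in N.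
Proof.
move=> cN aN wN; have [N0 _] := cN.
have tN (u : uenv g) (m : W) : m \in N -> tact u m \in N.
  elim/uind: u m; elim=> [x|||s hs|s hs t ht|k s hs|s hs t ht] m mN.
  - exact: aN.
  - by rewrite -[upi _]/(0 : uenv g) (lin0 (tact_linl m)).
  - by rewrite -[upi _]/(1 : uenv g) tact_one.
  - by rewrite upiN (linN (tact_linl m)); apply: submodN => //; exact: hs.
  - by rewrite upiD (linD (tact_linl m)); apply: submodD => //; [exact: hs | exact: ht].
  - by rewrite upiZ (linZ (tact_linl m)); apply: submodZ => //; exact: hs.
  - by rewrite upiM -tact_mul; apply: hs; exact: ht.
elim/tensor_ind => [|u hu|u v hu hv|b c] //.
- exact: submodN.
- exact: submodD.
have -> : pure _ _ b c = (c : K) *: (tact b wvec : W).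
  rewrite /wvec /ipure tact_pure mulr1 -[RHS]/(_ *: ipw b 1) -ipureZr.
  by congr (ipw b _); rewrite -[c in LHS]mulr1.
by apply: submodZ => //; exact: tN.
Qed.

Lemma wvec_act x : x \in gi_pred p -> sact x wvec = phi_ext phi x *: wvec.
Proof.
move=> px; rewrite /= /ind_act /wvec /ipure tact_pure mulr1.
have -> : uiota x = 1 * umap (ideal_incl p) (uiota (IdealType px : p)).
  by rewrite umap_iota mul1r.
rewrite pureA uact_iota /= -[LHS]/(ipw 1 (phi (IdealType px) *: 1)).
by rewrite ipureZr -(phi_extE phi).
Qed.

Lemma wvec_even : wvec \in hcomp W false.
Proof.
rewrite -[false]addbF; apply: ind_hcomp_pure => //; exact: uhcomp_one.
Qed.

End WhittakerVector.

(** * The irreducibility criterion *)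

Section Irreducibility.
Variables (K : numFieldType) (g : lieSuperalgebra K) (p : gradedIdeal g).
Variable phi : lieHom p (ground_lie K).
Local Notation W := (whittaker_module phi).
Local Notation L := (whittaker_annihilator phi).
Local Notation w := (wvec phi).

(** The filtration starting from V0 exhausts W(phi) because w generates it, so any nonzero vector of
    N has a degree from which to descend. *)
Lemma submodule_meet (V0 N : {pred W}) : submod_closed V0 ->
  (forall z v, z \in L -> v \in V0 -> sact z v \in V0) ->
  (forall x v, x \in gi_pred p -> v \in V0 -> sact x v = phi_ext phi x *: v) ->
  w \in V0 -> subsupermodule N -> ~ (forall m, m \in N -> m = 0) ->
  exists2 u, u \in V0 & u \in N /\ u != 0.
Proof.
move=> V0c V0L V0p wV0 [cN gN aN] nz.
have [v [vN v0]] : exists v, v \in N /\ v != 0.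
  apply: contrapT => nv; apply: nz => m mN; apply/eqP/negP => /negP ne.
  by apply: nv; exists m.
suff [d vd] : exists d, v \in fil V0 d by exact: (fil_meet V0c V0L V0p cN aN vd).
have mono d e u : u \in fil V0 d -> u \in fil V0 (e + d).
  by move=> hu; elim: e => // e IH; exact: filS.
pose U : {pred W} := [pred m | `[< exists d, m \in fil V0 d >]].
suff /asboolP : v \in U by [].
apply: wvec_generates.
- split; first by apply/asboolP; exists 0%N; case: V0c.
  move=> k a b /asboolP[d ad] /asboolP[e be]; apply/asboolP; exists (e + d)%N.
  have [_ cL] := fil_closed V0c (e + d).
  by apply: cL; [exact: mono | rewrite addnC; exact: mono].
- by move=> x m /asboolP[d md]; apply/asboolP; exists d.+1; exact: fil_act.
- by apply/asboolP; exists 0%N.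
Qed.

Lemma irreducible_annihilator_eq : L =i gi_pred p -> irreducible W.
Proof.
move=> LE N Nsub; have [cN gN aN] := Nsub.
have [?|nz] := pselect (forall m, m \in N -> m = 0); [by left|right].
pose V0 : {pred W} := [pred m | `[< exists a, m = a *: w >]].
have V0p x v : x \in gi_pred p -> v \in V0 -> sact x v = phi_ext phi x *: v.
  move=> xp /asboolP[a ->]; rewrite (linZ (@sact_linr _ _ _ x)) wvec_act //.
  by rewrite !scalerA mulrC.
have [|z v zL vV0||_ /asboolP[a ->] [aN' a0]] := @submodule_meet V0 N _ _ V0p _ Nsub nz.
- split; first by apply/asboolP; exists 0; rewrite scale0r.
  move=> k _ _ /asboolP[a ->] /asboolP[b ->]; apply/asboolP; exists (k * a + b).
  by rewrite scalerDl scalerA.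
- rewrite LE in zL; rewrite V0p //; case/asboolP: vV0 => a ->; apply/asboolP.
  by exists (phi_ext phi z * a); rewrite scalerA.
- by apply/asboolP; exists 1; rewrite scale1r.
apply: wvec_generates => //; have := submodZ a^-1 cN aN'.
by rewrite scalerA mulVf ?scale1r //; apply: contraNneq a0 => ->; rewrite scale0r.
Qed.

(** On w the square of e acts as the nonzero scalar phi([e, e]) / 2, so e w leads back to w. The
    grading separates the even and odd parts of the vector a w + b e w found in N. *)
Lemma irreducible_odd_line (e : g) : e \in L -> e \in hcomp g true ->
  (forall z, z \in L -> exists a, z - a *: e \in gi_pred p) ->
  br e e \in gi_pred p -> phi_ext phi (br e e) != 0 -> irreducible W.
Proof.
move=> eL e1 Lspan eep eenz N Nsub; have [cN gN aN] := Nsub.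
have [?|nz] := pselect (forall m, m \in N -> m = 0); [by left|right].
pose ew : W := sact e w.
have eew : sact e ew = (2^-1 * phi_ext phi (br e e)) *: w.
  have := sact_br w e1 e1; rewrite (wvec_act _ eep) /ssign /= scaleN1r opprK -/ew => E.
  by rewrite -scalerA E -mulr2n -scaler_nat scalerA mulVf ?scale1r // pnatr_eq0.
pose V0 : {pred W} := [pred m | `[< exists a b, m = a *: w + b *: ew >]].
have pew x : x \in gi_pred p -> sact x ew = phi_ext phi x *: ew.
  move=> xp.
  (* The commutator [y, e] kills w because e lies in L, and the sign matters only for odd y, where
     phi(y) = 0. *)
  have H i y : y \in gi_pred p -> y \in hcomp g i -> sact y ew = phi_ext phi y *: ew.
    move=> yp yi; rewrite /ew (sact_swap w yi e1).
    have /phi_kerP[bp b0] := annihilator_brl yp eL.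
    rewrite (wvec_act _ bp) b0 scale0r add0r (wvec_act _ yp) (linZ (@sact_linr _ _ _ e)).
    by case: i yi => yi; rewrite ?(phi_ext_odd phi yi) ?scale0r ?scaler0 // /ssign scale1r.
  have i0 := ideal_proj false xp; have i1 := ideal_proj true xp.
  have -> : sact x ew = sact (proj false x) ew + sact (proj true x) ew.
    by rewrite -(linD (@sact_linl _ _ _ ew)) -projE.
  rewrite (H _ _ i0 (proj_hom _ _)) (H _ _ i1 (proj_hom _ _)) -scalerDl.
  by rewrite -phi_extD // -projE.
have V0p x v : x \in gi_pred p -> v \in V0 -> sact x v = phi_ext phi x *: v.
  move=> xp /asboolP[a [b ->]]; rewrite (linD (@sact_linr _ _ _ x)).
  rewrite !(linZ (@sact_linr _ _ _ x)) wvec_act // pew // scalerDr !scalerA.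
  by rewrite [a * _]mulrC [b * _]mulrC.
have V0c : submod_closed V0.
  split; first by apply/asboolP; exists 0, 0; rewrite !scale0r addr0.
  move=> k _ _ /asboolP[a [b ->]] /asboolP[a' [b' ->]]; apply/asboolP.
  by exists (k * a + a'), (k * b + b'); rewrite !scalerDl scalerDr !scalerA addrACA.
have [z v zL vV0||_ /asboolP[a [b ->]] [vN v0]] := @submodule_meet V0 N V0c _ V0p _ Nsub nz.
- have [c hc] := Lspan _ zL.
  have -> : sact z v = sact (z - c *: e) v + c *: sact e v.
    by rewrite -(linZ (@sact_linl _ _ _ v)) -(linD (@sact_linl _ _ _ v)) subrK.
  rewrite V0p //; apply: submodD => //; apply: submodZ => //.
  case/asboolP: vV0 => a [b ->]; rewrite (linD (@sact_linr _ _ _ e)).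
  rewrite !(linZ (@sact_linr _ _ _ e)) eew; apply/asboolP.
  by exists (b * (2^-1 * phi_ext phi (br e e))), a; rewrite addrC scalerA.
- by apply/asboolP; exists 1, 0; rewrite scale1r scale0r addr0.
have h0 : a *: w \in hcomp W false by apply: submodZ; [exact: hcomp_closed | exact: wvec_even].
have h1 : b *: ew \in hcomp W true.
  apply: submodZ; first exact: hcomp_closed.
  exact: (sact_hom e1 (wvec_even phi)).
have aw : a *: w \in N.
  have := graded_proj false gN cN vN; rewrite (linD (@proj_lin _ _ _)) (proj_id h0).
  by rewrite [proj _ (b *: ew)]proj_other ?addr0.
have bw : b *: ew \in N.
  have := graded_proj true gN cN vN; rewrite (linD (@proj_lin _ _ _)) (proj_id h1).
  by rewrite [proj _ (a *: w)]proj_other ?add0r.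
apply: wvec_generates => //.
have [a0|an0] := eqVneq a 0; last first.
  by have := submodZ a^-1 cN aw; rewrite scalerA mulVf // scale1r.
have bn0 : b != 0.
  by apply: contraNneq v0 => ->; rewrite a0 !scale0r addr0.
have := aN e _ bw; rewrite (linZ (@sact_linr _ _ _ e)) eew scalerA => h.
set k := b * _ in h; have k0 : k != 0.
  by rewrite mulf_neq0 // mulf_neq0 // invr_eq0 pnatr_eq0.
by have := submodZ k^-1 cN h; rewrite scalerA mulVf // scale1r.
Qed.

End Irreducibility.

(** * Isotropic odd vectors and the equivalence *)

Lemma quadratic_root (C : numClosedFieldType) (a b c : C) : a != 0 ->
  exists t, a * t ^+ 2 + b * t + c = 0.
Proof.
move=> a0; pose r := sqrtC (b ^+ 2 - 4 * a * c).
have rE : r ^+ 2 = b ^+ 2 - 4 * a * c by exact: sqrtCK.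
exists ((r - b) / (2 * a)).
have -> : a * ((r - b) / (2 * a)) ^+ 2 + b * ((r - b) / (2 * a)) + c =
  (r ^+ 2 - b ^+ 2 + 4 * a * c) / (4 * a) by field.
by rewrite rE [_ - b ^+ 2]addrAC subrr add0r addNr mul0r.
Qed.

Theorem theorem3p4 (R : realType) (g : lieSuperalgebra R[i])
    (p : gradedIdeal g) (phi : lieHom p (ground_lie R[i])) :
  irreducible (whittaker_module phi) <->
  (whittaker_annihilator phi =i gi_pred p)
  \/
  [/\ part (whittaker_annihilator phi) false =i part (gi_pred p) false,
      quot_dim (part (whittaker_annihilator phi) true)
               (part (gi_pred p) true) 1
    & exists x : p,
        ival x \in bracket_span (part (whittaker_annihilator phi) true)
                                (part (whittaker_annihilator phi) true)
        /\ phi x <> 0].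
Proof.
set L := whittaker_annihilator phi.
have partP (N : {pred g}) i z :
  reflect (z \in N /\ z \in hcomp g i) (z \in part N i) by rewrite inE; exact: andP.
split=> [irr|[|[even_eq [_ [e [eL espan]]] [x [xspan xnz]]]]]; last 2 first.
- exact: irreducible_annihilator_eq.
- have /partP[e_L e1] := eL 0.
  have Lodd v : v \in part L true -> exists a, v - a *: e 0 \in part (gi_pred p) true.
    by move=> /espan [a [+ _]]; rewrite big_ord1; exists (a 0 0).
  have ee : br (e 0) (e 0) \in gi_pred p.
    suff /partP[] : br (e 0) (e 0) \in part (gi_pred p) false by [].
    rewrite -even_eq; apply/partP; split; first exact: annihilator_br.
    exact: (br_hom e1 e1).
  have Lspan z : z \in L -> exists a, z - a *: e 0 \in gi_pred p.
    move=> zL; have h0 : proj false z \in part L false.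
      by apply/partP; split; [exact: annihilator_proj | exact: proj_hom].
    have h1 : proj true z \in part L true.
      by apply/partP; split; [exact: annihilator_proj | exact: proj_hom].
    have [a /partP[ha _]] := Lodd _ h1; exists a.
    move: h0; rewrite even_eq => /partP[h0 _]; rewrite {1}(projE z) -addrA.
    by apply: submodD => //; exact: gi_submod.
  apply: (irreducible_odd_line e_L e1 Lspan ee).
  apply/negP => /eqP ee0; apply: xnz; rewrite -phi_extE.
  suff /phi_kerP[_ ->] : ival x \in phi_ker phi by [].
  (* Every bracket of odd elements of L is a multiple of [e, e] modulo the kernel of phi, so
     phi([e, e]) = 0 would make phi vanish on the whole bracket span. *)
  have cK := phi_ker_closed phi; have [K0 KL] := cK.
  move: xspan; move: (ival x); apply: span_of_ind => // _ [u [v [/Lodd[a ua] /Lodd[b vb] ->]]].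
  have [/partP[up _] /partP[vp _]] := (ua, vb).
  have ee_ker : br (e 0) (e 0) \in phi_ker phi by exact/phi_kerP.
  rewrite -[u](subrK (a *: e 0)) -[v](subrK (b *: e 0)).
  move: (u - _) (v - _) up vp => q r qp rp.
  rewrite (linD (@br_linl _ _ _)) (linZ (@br_linl _ _ _)) !(linD (@br_linr _ _ _)).
  rewrite !(linZ (@br_linr _ _ _)).
  have k1 := annihilator_brl qp (ideal_annihilator phi rp).
  have k2 := annihilator_brl qp e_L; have k3 := annihilatorP _ _ e_L _ rp.
  apply: submodD => //; first by apply: submodD => //; exact: submodZ.
  by apply: submodZ => //; apply: submodD => //; exact: submodZ.
have [/(_ _) ?|nLp] := pselect (L =i gi_pred p); [by left | right].
have pLsub : {subset gi_pred p <= L} by exact: ideal_annihilator.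
(* Irreducibility forces into p every homogeneous z in L with [z, z] in the kernel of phi; for even
   z this condition is automatic. *)
have red i z : z \in L -> z \in hcomp g i -> br z z \in phi_ker phi -> z \in gi_pred p.
  move=> zL zi zz; apply/negP => /negP zp.
  exact: (whittaker_reducible zi zL zp zz).
have even_sub z : z \in L -> z \in hcomp g false -> z \in gi_pred p.
  move=> zL z0; apply: (red false) => //.
  have -> : br z z = 0.
    by apply: sign_cap; rewrite {1}(br_skew z0 z0) /ssign /= scale1r.
  by case: (phi_ker_closed phi).
have even_eq : part L false =i part (gi_pred p) false.
  move=> z; apply/partP/partP => -[h0 h1]; split=> //; [exact: even_sub | exact: pLsub].
have oddsq u v : u \in L -> u \in hcomp g true -> v \in L -> v \in hcomp g true ->
    br u v \in gi_pred p.
  move=> uL u1 vL v1; apply: even_sub; first exact: annihilator_br.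
  exact: (br_hom u1 v1).
have [y [yL y1 yp]] : exists y, [/\ y \in L, y \in hcomp g true & y \notin gi_pred p].
  apply: contrapT => ny; apply: nLp => z; apply/idP/idP => [zL|]; last exact: pLsub.
  rewrite (projE z); apply: submodD; first exact: gi_submod.
    by apply: even_sub; [exact: annihilator_proj | exact: proj_hom].
  apply/negP => /negP n; apply: ny; exists (proj true z).
  by split=> //; [exact: annihilator_proj | exact: proj_hom].
have yy := oddsq y y yL y1 yL y1.
have yynz : phi_ext phi (br y y) != 0.
  by apply/negP => /eqP e; case/negP: yp; apply: (red true) => //; exact/phi_kerP.
have span v : v \in L -> v \in hcomp g true -> exists a, v - a *: y \in gi_pred p.
  move=> vL v1; have vv := oddsq v v vL v1 vL v1; have vy := oddsq v y vL v1 yL y1.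
  have cL := annihilator_closed phi; have c1 := hcomp_closed g true.
  (* The root t makes v + t y isotropic for z -> phi([z, z]), hence an element of p; so v is a
     multiple of y modulo p. *)
  have [t ht] := quadratic_root (2 * phi_ext phi (br v y)) (phi_ext phi (br v v)) yynz.
  exists (- t); rewrite scaleNr opprK; apply: (red true).
  - by apply: submodD => //; exact: submodZ.
  - by apply: submodD => //; exact: submodZ.
  rewrite (linD (@br_linl _ _ _)) (linZ (@br_linl _ _ _)) !(linD (@br_linr _ _ _)).
  rewrite !(linZ (@br_linr _ _ _)) (br_skew y1 v1) /ssign /= scaleN1r opprK.
  have cp := gi_submod p.
  have tp : t *: br v y \in gi_pred p by exact: submodZ.
  have typ : t *: br y y \in gi_pred p by exact: submodZ.
  apply/phi_kerP; split.
    apply: submodD => //; first by apply: submodD.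
    by apply: submodZ => //; exact: submodD.
  have Z k u : u \in gi_pred p -> phi_ext phi (k *: u) = k * phi_ext phi u.
    by move=> up; rewrite -[k *: u]addr0 phi_ext_lin // ?phi_ext0 ?addr0 //; case: cp.
  rewrite phi_extD; [|exact: submodD|by apply: submodZ => //; exact: submodD].
  rewrite (phi_extD phi vv tp) Z; last exact: submodD.
  rewrite (phi_extD phi vy typ) !Z // -ht; ring.
split=> //.
- split; first by move=> z /partP[zp z1]; apply/partP; split=> //; exact: pLsub.
  exists (fun=> y); split; first by move=> _; exact/partP.
  move=> v /partP[vL v1]; have [a ha] := span v vL v1; exists (const_mx a); split.
    rewrite big_ord1 mxE; apply/partP; split=> //.
    have c1 := hcomp_closed g true.
    by apply: submodD => //; apply: submodN => //; exact: submodZ.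
  move=> b; rewrite big_ord1 => /partP[hb _]; apply/rowP => j; rewrite ord1 mxE.
  by rewrite -(line_coordE yp ha) (line_coordE yp hb).
exists (IdealType yy : p); split; last by rewrite -phi_extE; exact/eqP.
by apply: span_of_gen; exists y, y; split=> //; exact/partP.
Qed.
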